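(* Let $\mathbb{A}$ be any set of allowable test processes. Consider a computable forecasting system $\varphi\colon\mathbb{S}\to\mathcal{I}$ and a path $\omega\in\Omega$ that is $\mathbb{A}$-random for $\varphi$. Let $(I_1,\dots,I_n,\dots)$ be the corresponding sequence of interval forecasts $I_n=\varphi(\omega_{1:n-1})$ for the path $\omega$. If $\sigma\colon\mathbb{N}\to\{0,1\}$ is a recursive selection function such that $\lim_{n\to\infty}\sum_{k=1}^{n}\sigma(k)=\infty$, then $$\liminf_{n\to\infty}\frac{\sum_{k=1}^{n}\sigma(k)\left[h(\omega_{k})-\underline{E}_{I_{k}}(h)\right]}{\sum_{k=1}^{n}\sigma(k)}\ge 0\quad\text{for any gamble }h\text{ on }\{0,1\}.$$ The same conclusion continues to hold when (instead of being $\mathbb{A}$-random) $\omega$ is Schnorr random for $\varphi$.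
   Context: Notation: $\mathbb{N}=\{1,2,\dots\}$, $\mathbb{N}_0=\mathbb{N}\cup\{0\}$. Situations are the finite binary sequences $\mathbb{S}=\bigcup_{n\in\mathbb{N}_0}\{0,1\}^n$, with $\square$ the empty sequence; $sx$ is $s$ with $x\in\{0,1\}$ appended. Paths are elements $\omega$ of $\Omega=\{0,1\}^{\mathbb{N}}$, with $n$-th entry $\omega_n$; $\omega_{1:n}\in\mathbb{S}$ consists of the first $n$ entries, $\omega_{1:0}=\square$. $\mathcal{I}$ is the set of non-empty closed subintervals of $[0,1]$. A gamble on $\{0,1\}$ is a map $f\colon\{0,1\}\to\mathbb{R}$. With $E_p(f)=pf(1)+(1-p)f(0)$, put $\underline{E}_I(f)=\min_{p\in I}E_p(f)$ and $\overline{E}_I(f)=\max_{p\in I}E_p(f)$ for $I\in\mathcal{I}$. A forecasting system is a map $\varphi\colon\mathbb{S}\to\mathcal{I}$, with $\underline{\varphi}(s)=\min\varphi(s)$ and $\overline{\varphi}(s)=\max\varphi(s)$. A selection function is a map $\sigma\colon\mathbb{N}\to\{0,1\}$. A real process is a map $F\colon\mathbb{S}\to\mathbb{R}$, with $\Delta F(s)(x)=F(sx)-F(s)$. A test process is a non-negative real process with $F(\square)=1$. A supermartingale for $\varphi$ is a real process $M$ with $\overline{E}_{\varphi(s)}(\Delta M(s))\le 0$ for all $s\in\mathbb{S}$; a test supermartingale for $\varphi$ is a test process that is a supermartingale for $\varphi$. Computability: ''recursive'' means computable by a Turing machine (countable sets such as $\mathbb{S}$ and $\mathbb{S}\times\mathbb{N}_0$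 are identified with $\mathbb{N}_0$ by recursive bijections with recursive inverse). A real process $F$ is computable if there are a recursive family of rationals $r_{s,n}$ and a recursive map $e\colon\mathbb{S}\times\mathbb{N}_0\to\mathbb{N}_0$ such that $n\ge e(s,N)$ implies $|r_{s,n}-F(s)|\le 2^{-N}$. A forecasting system $\varphi$ is computable if $\underline{\varphi}$ and $\overline{\varphi}$ are. A set of allowable test processes is any countable set $\mathbb{A}$ of test processes that contains all computable (strictly) positive test processes. A path $\omega$ is $\mathbb{A}$-random for $\varphi$ if $\sup_{n\in\mathbb{N}}T(\omega_{1:n})<\infty$ for every $T\in\mathbb{A}$ that is a test supermartingale for $\varphi$. A growth function is a recursive, non-decreasing, unbounded map $\rho\colon\mathbb{N}_0\to\mathbb{N}_0$. A path $\omega$ is Schnorr random for $\varphi$ if $\limsup_{n\to\infty}[T(\omega_{1:n})-\rho(n)]\le 0$ for all computable test supermartingales $T$ for $\varphi$ and all growth functions $\rho$. *)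

(* Defs.v *)
From Stdlib Require Cantor.
From HB Require Import structures.
From mathcomp Require Import all_boot all_order all_algebra.
From mathcomp Require Import all_classical all_reals all_analysis.

Set Implicit Arguments.
Unset Strict Implicit.
Unset Printing Implicit Defensive.

Import Order.TTheory GRing.Theory Num.Theory.
Import numFieldNormedType.Exports.

Local Open Scope classical_set_scope.
Local Open Scope ring_scope.

(* Deterministic Turing machines with k two-way infinite tapes. *)

Inductive move := MoveLeft | Stay | MoveRight.

(* [left] lists the cells to the left of the head, nearest first; [right] those
   to its right; all the cells that are not listed are blank. *)
Record tape (G : Type) := Tape { left : seq G; cur : G; right : seq G }.

Definition move_tape (G : Type) (blank : G) (d : move) (t : tape G) : tape G :=
  match d with
  | MoveLeft =>
      Tape (behead (left t)) (head blank (left t)) (cur t :: right t)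
  | Stay => t
  | MoveRight =>
      Tape (cur t :: left t) (head blank (right t)) (behead (right t))
  end.

Definition write_tape (G : Type) (a : G) (t : tape G) : tape G :=
  Tape (left t) a (right t).

(* The machine halts when [delta] is undefined. *)
Record machine (k : nat) := Machine {
  state : finType;
  symbol : finType;
  start : state;
  blank : symbol;
  stroke : symbol;
  stroke_neq_blank : stroke != blank;
  delta : state -> {ffun 'I_k -> symbol} ->
          option (state * {ffun 'I_k -> symbol * move}) }.

Definition config (k : nat) (M : machine k) : Type :=
  (state M * ('I_k -> tape (symbol M)))%type.

Definition step (k : nat) (M : machine k) (c : config M) : option (config M) :=
  omap (fun qa : state M * {ffun 'I_k -> symbol M * move} =>
          (qa.1, fun i => move_tape (blank M) (qa.2 i).2
                            (write_tape (qa.2 i).1 (c.2 i))))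
       (delta c.1 [ffun i => cur (c.2 i)]).

Definition steps (k : nat) (M : machine k) (t : nat) (c : config M) :
  option (config M) := iter t (obind (@step k M)) (Some c).

(* Natural numbers are written in unary: n strokes, the head being on the
   leftmost one, on an otherwise blank tape. *)
Definition unary_tape (k : nat) (M : machine k) (n : nat) : tape (symbol M) :=
  if n is n'.+1 then Tape [::] (stroke M) (nseq n' (stroke M))
  else Tape [::] (blank M) [::].

Definition reads_unary (k : nat) (M : machine k) (t : tape (symbol M))
    (n : nat) : Prop :=
  all (pred1 (blank M)) (left t) /\
  forall i : nat, nth (blank M) (cur t :: right t) i =
                  if (i < n)%N then stroke M else blank M.

(* The first tape holds the input, and the output upon halting. *)
Definition init_config (k : nat) (M : machine k.+1) (n : nat) : config M :=
  (start M, fun i => unary_tape M (if i == ord0 then n else 0%N)).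

Definition computes (k : nat) (M : machine k.+1) (f : nat -> nat) : Prop :=
  forall n : nat, exists (t : nat) (c : config M),
    [/\ steps t (init_config M n) = Some c, step c = None &
        reads_unary (c.2 ord0) (f n)].

Definition recursive (f : nat -> nat) : Prop :=
  exists (k : nat) (M : machine k.+1), computes M f.

(* Situations are finite binary sequences; sx is [rcons s x]. *)
Notation situation := (seq bool).

(* Sorts situations by length, then lexicographically. *)
Definition situation_code (s : situation) : nat :=
  foldl (fun (n : nat) (x : bool) => (n.*2 + x.+1)%N) 0%N s.

Definition situation_nat_code (d : situation * nat) : nat :=
  Cantor.to_nat (situation_code d.1, d.2).

Lemma situation_code_bij : bijective situation_code.
Proof.
have codeS s x :
    situation_code (rcons s x) = ((situation_code s).*2 + x.+1)%N.
  by rewrite /situation_code foldl_rcons.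
have inj : injective situation_code.
  elim/last_ind => [|s x IH] s'; case/lastP: s' => [|s' x'] //;
    rewrite ?codeS ?addnS // => -[e].
  have ex : x = x'.
    by move: (congr1 odd e); rewrite !oddD !odd_double !oddb.
  by move: e; rewrite ex => /eqP; rewrite eqn_add2r => /eqP /double_inj /IH ->.
have surj n : exists s, situation_code s = n.
  elim/ltn_ind: n => -[|n] IH; first by exists [::].
  have [|s Es] := IH n./2; first by rewrite ltnS -divn2 leq_div.
  by exists (rcons s (odd n)); rewrite codeS Es addnS addnC odd_double_half.
exists (fun n => xget [::] [set s | situation_code s = n]) => [s|n].
  by apply: inj; case: xgetP => [//|/(_ s)/=]; exact.
by case: xgetP => [//|none]; have [s /none] := surj n.
Qed.

Lemma situation_nat_code_bij : bijective situation_nat_code.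
Proof.
have [decode codeK decodeK] := situation_code_bij.
exists (fun n => (decode (Cantor.of_nat n).1, (Cantor.of_nat n).2)).
  by move=> [s n]; rewrite /situation_nat_code Cantor.cancel_of_to codeK.
move=> n; rewrite /situation_nat_code decodeK -[RHS]Cantor.cancel_to_of.
by case: (Cantor.of_nat n).
Qed.

Definition recursive_via (D : Type) (code : D -> nat) (f : D -> nat) : Prop :=
  exists2 g : nat -> nat, recursive g & forall d, f d = g (code d).

Definition recursive_rationals (r : situation * nat -> rat) : Prop :=
  exists sg num den : situation * nat -> nat,
    [/\ recursive_via situation_nat_code sg,
        recursive_via situation_nat_code num,
        recursive_via situation_nat_code den &
        forall d, (0 < den d)%N /\
                  r d = (-1) ^+ sg d * (num d)%:R / (den d)%:R].

(* Paths and selection functions, both indexed by {1, 2, ...} in the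
   mathematics, are indexed from 0 here: [omega k] is the (k+1)-st entry. *)
Notation binary_path := (nat -> bool).

Notation selection_function := (nat -> bool).

Definition recursive_selection (sigma : selection_function) : Prop :=
  recursive (fun k => nat_of_bool (sigma k)).

Definition initial_segment (omega : binary_path) (n : nat) : situation :=
  mkseq omega n.

Section Forecasting.
Context {R : realType}.
Implicit Types (f : bool -> R) (F M T : situation -> R) (omega : binary_path).

(* A non-empty closed subinterval [lower_end, upper_end] of [0, 1]. *)
Record interval_forecast := IntervalForecast {
  lower_end : R;
  upper_end : R;
  lower_end_ge0 : 0 <= lower_end;
  lower_le_upper : lower_end <= upper_end;
  upper_end_le1 : upper_end <= 1 }.

Definition interval_set (I : interval_forecast) : set R :=
  [set p | lower_end I <= p <= upper_end I].

Definition expectation (p : R) f : R := p * f true + (1 - p) * f false.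

(* The infimum and supremum are attained: the expectation is affine in p. *)
Definition lower_expectation (I : interval_forecast) f : R :=
  inf [set expectation p f | p in interval_set I].

Definition upper_expectation (I : interval_forecast) f : R :=
  sup [set expectation p f | p in interval_set I].

Definition forecasting_system := situation -> interval_forecast.
Implicit Types phi : forecasting_system.

Definition difference F (s : situation) (x : bool) : R := F (rcons s x) - F s.

Definition test_process F : Prop := (forall s, 0 <= F s) /\ F [::] = 1.

Definition supermartingale phi M : Prop :=
  forall s, upper_expectation (phi s) (difference M s) <= 0.

Definition test_supermartingale phi T : Prop :=
  test_process T /\ supermartingale phi T.

Definition computable_process F : Prop :=
  exists (r : situation * nat -> rat) (e : situation * nat -> nat),
    [/\ recursive_rationals r, recursive_via situation_nat_code e &
        forall (s : situation) (N n : nat), (e (s, N) <= n)%N ->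
          `|ratr (r (s, n)) - F s| <= 2 ^- N].

Definition computable_forecasting_system phi : Prop :=
  computable_process (fun s => lower_end (phi s)) /\
  computable_process (fun s => upper_end (phi s)).

Definition allowable (A : set (situation -> R)) : Prop :=
  [/\ countable A, A `<=` test_process &
      forall F, test_process F -> (forall s, 0 < F s) ->
        computable_process F -> A F].

Definition allowable_random (A : set (situation -> R)) phi omega : Prop :=
  forall T, A T -> test_supermartingale phi T ->
    (ereal_sup [set (T (initial_segment omega n))%:E | n in [set n | 0 < n]%N]
       < +oo)%E.

Definition growth_function (rho : nat -> nat) : Prop :=
  [/\ recursive rho, {homo rho : m n / (m <= n)%N} &
      forall B : nat, exists n : nat, (B < rho n)%N].

Definition schnorr_random phi omega : Prop :=
  forall T (rho : nat -> nat),
    computable_process T -> test_supermartingale phi T ->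
    growth_function rho ->
    (limn_esup (fun n => (T (initial_segment omega n) - (rho n)%:R)%:E) <= 0)%E.

Definition forecast_along phi omega (k : nat) : interval_forecast :=
  phi (initial_segment omega k).

Definition selected_average (I : nat -> interval_forecast)
    (sigma : selection_function) (h : bool -> R) omega (n : nat) : R :=
  (\sum_(k < n) (sigma k)%:R * (h (omega k) - lower_expectation (I k) h))
  / \sum_(k < n) (sigma k)%:R.

End Forecasting.

Arguments interval_forecast : clear implicits.
Arguments forecasting_system : clear implicits.

(* Main.v *)
(** Say that an end point P of the forecasts is wrong in the long run when the
    selected average of ±(P - omega) stays infinitely often above a positive
    constant.  Betting the fixed fraction 1/K of the current capital against
    that end point at each selected time is then profitable: from
    1 + x >= exp (x - 2 x^2) the capital after N selected outcomes is infinitely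
    often at least exp (N / K^2) >= N + 1, where K is large compared to the
    inverse of the constant.  The expectation of a gamble being affine, a
    negative lower limit for h forces one of the two end points to be wrong, the
    choice depending on the sign of h(1) - h(0); the gamble h itself need not be
    computable.

    The capital process is positive and computable, hence it is allowable; for
    Schnorr randomness the growth function is the number of selected times.

    Computability of the capital rests on a closure theorem for the functions
    computed by multi-tape machines: a register program may use any given
    machine as a subroutine, provided that the tapes of the latter can be erased
    after each call, and such programs are closed under primitive recursion. *)
Require Import Defs.
From mathcomp Require Import all_boot all_order all_algebra.
From mathcomp Require Import all_classical all_reals all_analysis.
From mathcomp Require Import perm zify ring lra.

Import Order.TTheory GRing.Theory Num.Theory.
Import numFieldNormedType.Exports.

Set Implicit Arguments.
Unset Strict Implicit.
Unset Printing Implicit Defensive.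

(** * Machine fragments *)

Definition upd (I : eqType) (T : Type) (t : I -> T) (i : I) (x : T) : I -> T :=
  fun j => if j == i then x else t j.

Lemma upd_eq (I : eqType) T (t : I -> T) i x : upd t i x i = x.
Proof. by rewrite /upd eqxx. Qed.

Lemma upd_neq (I : eqType) T (t : I -> T) i x j : j != i -> upd t i x j = t j.
Proof. by rewrite /upd => /negbTE ->. Qed.

Lemma upd_id (I : eqType) T (t : I -> T) i : upd t i (t i) = t.
Proof. by apply/funext => j; rewrite /upd; case: eqP => // ->. Qed.

Lemma upd_upd (I : eqType) T (t : I -> T) i x y : upd (upd t i x) i y = upd t i y.
Proof. by apply/funext => j; rewrite /upd; case: eqP. Qed.

(** Each side of the head is a total function, so that two lists which differ only by trailing
    blanks give equal tapes. *)
Record ftape (G : Type) :=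
  FTape { fleft : nat -> G; fcur : G; fright : nat -> G }.

Definition fcons (G : Type) (a : G) (f : nat -> G) (i : nat) : G :=
  if i is i'.+1 then f i' else a.

Definition fmove (G : Type) (d : move) (t : ftape G) : ftape G :=
  match d with
  | MoveLeft => FTape (fun i => fleft t i.+1) (fleft t 0) (fcons (fcur t) (fright t))
  | Stay => t
  | MoveRight => FTape (fcons (fcur t) (fleft t)) (fright t 0) (fun i => fright t i.+1)
  end.

Definition fact (G : Type) (am : G * move) (t : ftape G) : ftape G :=
  fmove am.2 (FTape (fleft t) am.1 (fright t)).

Definition fmap (G H : Type) (h : G -> H) (t : ftape G) : ftape H :=
  FTape (h \o fleft t) (h (fcur t)) (h \o fright t).

Definition ftape_of (G : Type) (b : G) (t : tape G) : ftape G :=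
  FTape (nth b (left t)) (cur t) (nth b (right t)).

Lemma fact_stay (G : Type) (t : ftape G) : fact (fcur t, Stay) t = t.
Proof. by case: t. Qed.

Lemma ftape_of_act (G : Type) (b a : G) d t :
  ftape_of b (move_tape b d (write_tape a t)) = fact (a, d) (ftape_of b t).
Proof.
case: t => l c r; case: d => //=; rewrite /ftape_of /fact /=; congr FTape;
  rewrite ?nth0 //; apply/funext => -[|i] //=; by rewrite nth_behead.
Qed.

Lemma fmap_act (G H : Type) (h : G -> H) a d t :
  fmap h (fact (a, d) t) = fact (h a, d) (fmap h t).
Proof.
by case: d => //; rewrite /fmap /fact /=; congr FTape; apply/funext => -[].
Qed.

Section Fragments.
Variables (I G : finType).
Implicit Types (t : I -> ftape G).

(** A piece of control flow with one entry and one exit: the next state [None] leaves the fragment,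
    after the accompanying action has been performed. Tapes are indexed by any finite type, which
    lets fragments be combined without renumbering. *)
Record fragment := Fragment {
  fstate : finType;
  fstart : fstate;
  fdelta : fstate -> (I -> G) -> option fstate * (I -> G * move) }.

Definition heads t : I -> G := fun i => fcur (t i).

Definition fapply (a : I -> G * move) t : I -> ftape G :=
  fun i => fact (a i) (t i).

Inductive runs_from (F : fragment) :
    fstate F -> (I -> ftape G) -> (I -> ftape G) -> Prop :=
  | runs_exit q t a : fdelta q (heads t) = (None, a) ->
      runs_from q t (fapply a t)
  | runs_step q q' a t t' : fdelta q (heads t) = (Some q', a) ->
      runs_from q' (fapply a t) t' -> runs_from q t t'.

Definition runs (F : fragment) := @runs_from F (fstart F).

Definition idle (r : I -> G) : I -> G * move := fun i => (r i, Stay).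

Lemma fapply_idle t : fapply (idle (heads t)) t = t.
Proof. by apply/funext => i; apply: fact_stay. Qed.

Definition op_frag (i : I) (g : G -> G * move) : fragment :=
  @Fragment unit tt (fun _ r => (None, upd (idle r) i (g (r i)))).

Definition seq_frag (A B : fragment) : fragment :=
  @Fragment (fstate A + fstate B)%type (inl (fstart A)) (fun q r =>
    match q with
    | inl q => let: (q', a) := fdelta q r in
               (Some (if q' is Some q' then inl q' else inr (fstart B)), a)
    | inr q => let: (q', a) := fdelta q r in (omap inr q', a)
    end).

Definition while_frag (i : I) (p : pred G) (A : fragment) : fragment :=
  @Fragment (option (fstate A)) None (fun q r =>
    match q with
    | None => (if p (r i) then Some (Some (fstart A)) else None, idle r)
    (* The exit [None] of the body is, under [Some], the test state of the loop, so leaving the body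
       returns to the test. *)
    | Some q => let: (q', a) := fdelta q r in (Some q', a)
    end).

Definition skip_frag : fragment := @Fragment unit tt (fun _ r => (None, idle r)).

Lemma runs_skip t : runs skip_frag t t.
Proof. rewrite -[X in runs _ _ X]fapply_idle; exact: runs_exit. Qed.

Lemma runs_op i g t :
  runs (op_frag i g) t (upd t i (fact (g (fcur (t i))) (t i))).
Proof.
set t' := upd _ _ _.
have -> : t' = fapply (upd (idle (heads t)) i (g (fcur (t i)))) t.
  apply/funext => j; rewrite /t' /upd /fapply; case: eqP => [->//|_].
  by rewrite fact_stay.
exact: runs_exit.
Qed.

Lemma runs_seq A B t1 t2 t3 :
  runs A t1 t2 -> runs B t2 t3 -> runs (seq_frag A B) t1 t3.
Proof.
rewrite /runs /= => hA hB.
have {}hB : @runs_from (seq_frag A B) (inr (fstart B)) t2 t3.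
  elim: hB => [q t a e|q q' a t t' e _ IH].
    by apply: runs_exit; rewrite /= e.
  by apply: runs_step IH; rewrite /= e.
elim: hA hB => {t1 t2} [q t a e hB|q q' a t t' e _ IH /IH {}IH].
  by apply: runs_step hB; rewrite /= e.
by apply: runs_step IH; rewrite /= e.
Qed.

Lemma runs_while_exit i (p : pred G) A t :
  ~~ p (fcur (t i)) -> runs (while_frag i p A) t t.
Proof.
move=> /negbTE np; rewrite -[X in runs _ _ X]fapply_idle.
by apply: runs_exit; rewrite /= /heads np.
Qed.

Lemma runs_while_step i (p : pred G) A t1 t2 t3 :
  p (fcur (t1 i)) -> runs A t1 t2 -> runs (while_frag i p A) t2 t3 ->
  runs (while_frag i p A) t1 t3.
Proof.
move=> pt hA hW.
have {hA hW} : @runs_from (while_frag i p A) (Some (fstart A)) t1 t3.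
  rewrite /runs /= in hA hW.
  elim: hA hW => {pt t1 t2} [q t a e hW|q q' a t t' e _ IH /IH {}IH].
    by apply: runs_step hW; rewrite /= e.
  by apply: runs_step IH; rewrite /= e.
rewrite -{1}[t1]fapply_idle; apply: runs_step.
by rewrite /= /heads pt.
Qed.

End Fragments.

(** * Compiling a fragment into a multi-tape machine *)

Section FragmentMachine.
Variables (I G : finType) (F : fragment I G) (z o : G) (oz : o != z).
Variables (k : nat) (e : 'I_k.+1 -> I) (e' : I -> 'I_k.+1).
Hypothesis (e'K : cancel e' e).

(** The added state [None] is the halting one: there, and only there, [delta] is undefined. *)
Definition fragment_machine : machine k.+1 :=
  @Machine k.+1 (option (fstate F)) G (Some (fstart F)) z o oz (fun q r =>
    if q is Some q then
      let: (q', a) := fdelta q (fun i => r (e' i)) in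
      Some (q', [ffun x => a (e x)])
    else None).

Let M := fragment_machine.

Lemma steps_fragment_machine q t t' (tp : 'I_k.+1 -> tape G) :
  runs_from q t t' -> (forall x, ftape_of z (tp x) = t (e x)) ->
  exists n tp', steps n ((Some q, tp) : config M) = Some (None, tp') /\
    forall x, ftape_of z (tp' x) = t' (e x).
Proof.
move=> h; elim: h tp => {q t t'} [q t a E|q q' a t t' E _ IH] tp tpE.
all: have hd : (fun i => [ffun x => cur (tp x)] (e' i)) = heads t by
  apply/funext => i; rewrite ffunE /heads -{2}[i]e'K -tpE.
all: pose tp1 x := move_tape z (a (e x)).2 (write_tape (a (e x)).1 (tp x)).
all: have tp1E x : ftape_of z (tp1 x) = fapply a t (e x) by
  rewrite ftape_of_act tpE /fapply; case: (a (e x)).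
- exists 1, tp1; split=> //; rewrite /steps /= /step /= hd E /=.
  by congr (Some (_, _)); apply/funext => x; rewrite ffunE.
- have [n [tp' [E1 E2]]] := IH _ tp1E.
  exists n.+1, tp'; split=> //; rewrite -E1 /steps iterSr /= /step /= hd E /=.
  congr (iter _ _ (Some (_, _))); by apply/funext => x; rewrite ffunE.
Qed.

End FragmentMachine.

(** * A given machine as a fragment *)

Section EmbeddedMachine.
Variables (I G : finType) (k : nat) (M : machine k).
Variables (u : 'I_k -> I) (u_inj : injective u).
Variables (dec : G -> symbol M) (enc : symbol M -> G) (encK : cancel enc dec).
Variables (z : G) (enc_neq : forall x, enc x != z) (decz : dec z = blank M).

Definition machine_frag : fragment I G :=
  @Fragment I G (state M) (start M) (fun q r =>
    if delta q [ffun x => dec (r (u x))] is Some (q', a) then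
      (Some q', fun i => if [pick x | u x == i] is Some x
                         then (enc (a x).1, (a x).2) else idle r i)
    else (None, idle r)).

(* The non-[z] cells form, together with the cell under the head, an interval
   around the head; hence the tape can be erased by sweeping it. *)
Definition contiguous (t : ftape G) : Prop :=
  exists a b, forall i,
    (fleft t i != z) = (i < a)%N /\ (fright t i != z) = (i < b)%N.

(** When the head moves, the written cell joins the interval behind it, and the side ahead loses its
    nearest cell, if it has one. *)
Lemma contiguous_act a d t : a != z -> contiguous t -> contiguous (fact (a, d) t).
Proof.
move=> az [l [r lr]]; case: d; rewrite /fact /contiguous /=.
- exists l.-1, r.+1 => i; have [_ ri] := lr i; have [ni _] := lr i.+1; split.
    by rewrite ni; case: (l).
  by case: i {ni ri} => [|i] //=; have [] := lr i.
- by exists l, r.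
- exists l.+1, r.-1 => i; have [_ ri] := lr i; have [_ ni] := lr i.+1; split.
    by case: i {ni ri} => [|i] //=; have [] := lr i.
  by rewrite ni; case: (r).
Qed.

(** The simulation keeps three invariants: the decoded tapes are those of [M], they stay contiguous
    because every written cell [enc x] differs from [z], and tapes outside the image of [u] are
    untouched. *)
Lemma runs_machine_frag n q tp (c : config M) (t : I -> ftape G) :
  steps n ((q, tp) : config M) = Some c -> step c = None ->
  (forall x, fmap dec (t (u x)) = ftape_of (blank M) (tp x)) ->
  (forall x, contiguous (t (u x))) ->
  exists t', [/\ @runs_from _ _ machine_frag q t t',
    forall x, fmap dec (t' (u x)) = ftape_of (blank M) (c.2 x),
    forall x, contiguous (t' (u x)) &
    forall i, (forall x, u x != i) -> t' i = t i].
Proof.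
move=> hn hc; elim: n q tp t hn => [|n IH] q tp t.
all: rewrite /steps ?iterSr /=; set c0 : config M := (q, tp) => hn tE tC.
all: have rd : [ffun x => dec (heads t (u x))] = [ffun x => cur (c0.2 x)] by
  apply/ffunP => x; rewrite !ffunE; have /(congr1 (@fcur _)) := tE x.
- case: hn hc => <- hc; exists t; split=> //.
  rewrite -{2}[t]fapply_idle; apply: runs_exit.
  by rewrite /= rd; move: hc; rewrite /step /=; case: (delta _ _).
case Ed: (delta q [ffun x => cur (c0.2 x)]) => [[q' a]|]; last first.
  have en m : iter m (obind (@step k M)) None = None by elim: m => //= m ->.
  by move: hn; rewrite /step /= Ed /= en.
move: hn; rewrite /step /= Ed /= => hn.
pose act i := if [pick x | u x == i] is Some x
              then (enc (a x).1, (a x).2) else idle (heads t) i.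
have actu x : act (u x) = (enc (a x).1, (a x).2).
  rewrite /act; case: pickP => [y /eqP/u_inj -> //|/(_ x)]; by rewrite eqxx.
have [|x|t' [h1 h2 h3 h4]] := IH _ _ (fapply act t) hn.
- by move=> x; rewrite /fapply actu fmap_act encK ftape_of_act tE.
- by rewrite /fapply actu; apply: contiguous_act.
exists t'; split=> //; first by apply: runs_step h1; rewrite /= rd Ed.
move=> i ui; rewrite h4 // /fapply /act; case: pickP => [x /eqP xi|_].
  by have := ui x; rewrite xi eqxx.
exact: fact_stay.
Qed.

End EmbeddedMachine.

(** * Unary registers and subroutine calls *)

Section UnaryTapes.
Variables (I G : finType) (z o : G) (oz : o != z).
Implicit Types v : I -> nat.

Definition unary_ftape (n : nat) : ftape G :=
  FTape (fun _ => z) (if (0 < n)%N then o else z)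
        (fun i => if (i.+1 < n)%N then o else z).

Definition unaries v : I -> ftape G := fun i => unary_ftape (v i).

Definition does (F : fragment I G) v v' := runs F (unaries v) (unaries v').

Lemma unaries_upd v i n : unaries (upd v i n) = upd (unaries v) i (unary_ftape n).
Proof. by apply/funext => j; rewrite /unaries /upd; case: eqP. Qed.

Lemma fcur_unary n : (fcur (unary_ftape n) == o) = (0 < n)%N.
Proof. by case: n => [|n] /=; rewrite ?eqxx // eq_sym (negbTE oz). Qed.

(** The head stands on the leftmost stroke, and has to make room for a new one; for the number 0 it
    already stands on a blank. *)
Definition inc_frag i : fragment I G :=
  seq_frag (op_frag i (fun g => (g, if g == o then MoveLeft else Stay)))
           (op_frag i (fun _ => (o, Stay))).

(** On an empty tape this changes nothing, which makes it the truncated predecessor. *)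
Definition dec_frag i : fragment I G := op_frag i (fun _ => (z, MoveRight)).

Definition loop_frag i F : fragment I G := while_frag i (pred1 o) F.

Definition move_frag i j := loop_frag i (seq_frag (dec_frag i) (inc_frag j)).

Definition clear_frag i := loop_frag i (dec_frag i).

(** Counting register [i] down destroys it; the scratch register [k] receives a second copy, from
    which [i] is restored. *)
Definition copy_frag i j k :=
  seq_frag
    (loop_frag i (seq_frag (dec_frag i) (seq_frag (inc_frag j) (inc_frag k))))
    (move_frag k i).

Lemma does_seq A B v1 v2 v3 :
  does A v1 v2 -> does B v2 v3 -> does (seq_frag A B) v1 v3.
Proof. exact: runs_seq. Qed.

Lemma does_skip v : does (skip_frag I G) v v.
Proof. exact: runs_skip. Qed.

Lemma runs_inc i n t : t i = unary_ftape n ->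
  runs (inc_frag i) t (upd t i (unary_ftape n.+1)).
Proof.
move=> ti; apply: runs_seq; first exact: runs_op.
set t1 := upd _ _ _.
have -> : upd t i (unary_ftape n.+1) = upd t1 i (fact (o, Stay) (t1 i));
  last exact: runs_op.
rewrite /t1 upd_eq upd_upd ti; congr upd; rewrite fcur_unary.
case: n {ti t1} => [|n]; rewrite /fact /unary_ftape /=; congr FTape.
by apply/funext => -[|m].
Qed.

Lemma does_inc i v : does (inc_frag i) v (upd v i (v i).+1).
Proof. by rewrite /does unaries_upd; apply: runs_inc. Qed.

Lemma does_dec i v : does (dec_frag i) v (upd v i (v i).-1).
Proof.
rewrite /does unaries_upd.
have -> : unary_ftape (v i).-1 = fact (z, MoveRight) (unaries v i);
  last exact: runs_op.
rewrite /fact /unaries /unary_ftape /=; congr FTape.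
- by apply/funext => -[].
- by case: (v i) => [|[]].
- by apply/funext => m; case: (v i).
Qed.

Lemma does_loop_exit i F v : v i = 0%N -> does (loop_frag i F) v v.
Proof. by move=> vi; apply: runs_while_exit; rewrite /= fcur_unary vi. Qed.

Lemma does_loop_step i F v1 v2 v3 : (0 < v1 i)%N ->
  does F v1 v2 -> does (loop_frag i F) v2 v3 -> does (loop_frag i F) v1 v3.
Proof. by move=> vi; apply: runs_while_step; rewrite /= fcur_unary. Qed.

Lemma does_clear i v : does (clear_frag i) v (upd v i 0%N).
Proof.
have [n] := ubnP (v i); elim: n v => // n IH v vn.
have [vi|vi] := posnP (v i).
  by rewrite -[X in upd v i X]vi upd_id; apply: does_loop_exit.
apply: (does_loop_step vi); first exact: does_dec.
rewrite -(upd_upd v i (v i).-1 0%N); apply: IH; rewrite upd_eq; lia.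
Qed.

Lemma does_move i j v : i != j ->
  does (move_frag i j) v (upd (upd v j (v j + v i)%N) i 0%N).
Proof.
move=> ij; have [n] := ubnP (v i); elim: n v => // n IH v vn.
have [vi|vi] := posnP (v i).
  by rewrite vi addn0 upd_id -[X in upd v i X]vi upd_id; apply: does_loop_exit.
apply: (does_loop_step vi).
  apply: does_seq; [exact: does_dec | exact: does_inc].
rewrite (@upd_neq _ _ _ i) 1?eq_sym //; set v' := upd _ _ _.
have vi' : v' i = (v i).-1 by rewrite /v' upd_neq // upd_eq.
have vj' : v' j = (v j).+1 by rewrite /v' upd_eq.
have -> : upd (upd v j (v j + v i)%N) i 0%N = upd (upd v' j (v' j + v' i)%N) i 0%N.
  rewrite vi' vj'; apply/funext => x; rewrite /v' /upd.
  by case: eqP => // _; case: eqP => // _; lia.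
by apply: IH; lia.
Qed.

Lemma does_copy i j k v : i != j -> i != k -> j != k -> v k = 0%N ->
  does (copy_frag i j k) v (upd v j (v j + v i)%N).
Proof.
move=> ij ik jk vk.
have [ji ki kj] : [/\ j != i, k != i & k != j] by rewrite !(eq_sym _ i) (eq_sym k).
apply: (@does_seq _ _ _ (upd (upd (upd v i 0%N) k (v i)) j (v j + v i)%N)); last first.
  set w := upd _ _ _; have -> : upd v j (v j + v i)%N =
    upd (upd w i (w i + w k)%N) k 0%N; last exact: does_move.
  apply/funext => x; rewrite /w /upd !eqxx.
  rewrite (negbTE ij) (negbTE ik) (negbTE kj).
  case: (eqVneq x k) => [->|xk]; first by rewrite (negbTE kj).
  by case: (eqVneq x i) => [->|xi]; rewrite ?(negbTE ij).
(* Register [k] grows during the loop, so the induction needs the claim for an arbitrary initial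
   [v k]; the hypothesis that it is 0 is dropped. *)
have -> : upd (upd v i 0%N) k (v i) = upd (upd v i 0%N) k (v k + v i)%N by rewrite vk.
move: vk => _.
have [n] := ubnP (v i); elim: n v => // n IH v vn.
have [vi|vi] := posnP (v i).
  have -> : upd (upd (upd v i 0%N) k (v k + v i)%N) j (v j + v i)%N = v.
    by rewrite vi !addn0 -[X in upd v i X]vi !upd_id.
  exact: does_loop_exit.
apply: (does_loop_step vi).
  apply: does_seq; first exact: does_dec.
  apply: does_seq; exact: does_inc.
rewrite !(@upd_neq _ _ _ i) //; rewrite (@upd_neq _ _ _ j) // (@upd_neq _ _ _ i) //.
set v' := upd _ _ _.
have vi' : v' i = (v i).-1 by rewrite /v' 2?upd_neq // upd_eq.
have vj' : v' j = (v j).+1 by rewrite /v' upd_neq // upd_eq.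
have vk' : v' k = (v k).+1 by rewrite /v' upd_eq.
have -> : upd (upd (upd v i 0%N) k (v k + v i)%N) j (v j + v i)%N =
   upd (upd (upd v' i 0%N) k (v' k + v' i)%N) j (v' j + v' i)%N.
  rewrite vi' vj' vk'; apply/funext => x; rewrite /v' /upd.
  do 3![case: eqP => [_|_]; first by lia]; by [].
by apply: IH; lia.
Qed.

End UnaryTapes.

(** * Subroutine calls of given machines *)

Section OracleCalls.
Variables (J : finType) (kk : J -> nat) (M : forall j, machine (kk j).+1).
Variables (f : J -> nat -> nat) (Mf : forall j, computes (M j) (f j)).

(* [None] is the blank and [Some None] the stroke of the registers; a cell that
   was visited by machine [j] holds [Some (Some (Tagged _ x))], even when it
   represents the blank [x] of that machine. *)
Definition cell : finType := option (option {j : J & symbol (M j)}).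

Definition zcell : cell := None.
Definition ocell : cell := Some None.

Lemma ocell_neq : ocell != zcell. Proof. by []. Qed.

(** The blank and the stroke of the registers are read as those of machine [j], so a register
    content is directly a valid input; a symbol of another machine is read as the blank by
    default. *)
Definition dec_cell (j : J) (g : cell) : symbol (M j) :=
  match g with
  | None => blank (M j)
  | Some None => stroke (M j)
  | Some (Some u) => tagged_as (Tagged (fun j => symbol (M j)) (blank (M j))) u
  end.

Definition enc_cell (j : J) (x : symbol (M j)) : cell :=
  Some (Some (Tagged (fun j => symbol (M j)) x)).

Lemma enc_cellK j : cancel (@enc_cell j) (@dec_cell j).
Proof. by move=> x; rewrite /dec_cell /enc_cell tagged_asE. Qed.

Variable K : nat.

Definition tape_index : finType := ('I_K.+1 + {j : J & 'I_(kk j).+1})%type.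

Notation I := tape_index.

Definition oracle_tape (j : J) (x : 'I_(kk j).+1) : I :=
  inr (Tagged (fun j => 'I_(kk j).+1) x).

Lemma oracle_tape_inj j : injective (@oracle_tape j).
Proof. by move=> x y [] /eqP; rewrite -/(Tagged _ x) -/(Tagged _ y) eq_Tagged => /eqP. Qed.

(** The current cell, possibly [zcell], is marked first so that the visited cells form one block.
    The head then runs to the right end of the block and erases it from right to left. *)
Definition erase_frag (i : I) : fragment I cell :=
  seq_frag (op_frag i (fun _ => (ocell, Stay)))
  (seq_frag (while_frag i (predC1 zcell) (op_frag i (fun g => (g, MoveRight))))
  (seq_frag (op_frag i (fun g => (g, MoveLeft)))
            (while_frag i (predC1 zcell) (op_frag i (fun _ => (zcell, MoveLeft)))))).

Definition erase_all_frag (s : seq I) : fragment I cell :=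
  foldr (fun i F => seq_frag (erase_frag i) F) (skip_frag I cell) s.

Definition call_frag (j : J) (r : I) : fragment I cell :=
  let i := @oracle_tape j ord0 in
  seq_frag (move_frag zcell ocell r i)
  (seq_frag (machine_frag (@oracle_tape j) (@dec_cell j) (@enc_cell j))
  (seq_frag (while_frag i (fun g => dec_cell j g == stroke (M j))
               (seq_frag (op_frag i (fun g => (g, MoveRight)))
                         (inc_frag ocell r)))
            (erase_all_frag [seq @oracle_tape j x | x <- enum 'I_(kk j).+1]))).

(** Here [a] counts the visited cells behind the head and [m] those from the head on; each move
    shifts one from [m] to [a]. *)
Lemma runs_sweep_right (i : I) m a t :
  (forall k, (fleft (t i) k != zcell) = (k < a)%N) ->
  (forall k, (fcons (fcur (t i)) (fright (t i)) k != zcell) = (k < m)%N) ->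
  exists2 t', runs (while_frag i (predC1 zcell) (op_frag i (fun g => (g, MoveRight))))
                   t (upd t i t') &
    (forall k, (fleft t' k != zcell) = (k < a + m)%N) /\
    (forall k, fcons (fcur t') (fright t') k = zcell).
Proof.
elim: m a t => [|m IH] a t hl hr.
  have hz k : fcons (fcur (t i)) (fright (t i)) k = zcell.
    by apply/eqP; rewrite -[_ == _]negbK hr.
  exists (t i); last by split=> // k; rewrite hl addn0.
  by rewrite upd_id; apply: runs_while_exit; rewrite /= (hz 0%N : fcur (t i) = zcell) eqxx.
have hc : fcur (t i) != zcell by rewrite (hr 0%N).
set t1 := upd t i (fact (fcur (t i), MoveRight) (t i)).
have t1i : t1 i = fact (fcur (t i), MoveRight) (t i) by rewrite /t1 upd_eq.
have [||t' h1 [h2 h3]] := IH a.+1 t1.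
- by rewrite t1i => -[|k] /=; [rewrite hc | rewrite hl].
- by rewrite t1i => k; rewrite -[RHS](hr k.+1) /=; case: k.
exists t'; last by split=> // k; rewrite h2 addSnnS.
rewrite /t1 upd_upd in h1.
exact: (runs_while_step hc (runs_op _ _ _) h1).
Qed.

Lemma runs_sweep_left (i : I) m t :
  (forall k, (fcons (fcur (t i)) (fleft (t i)) k != zcell) = (k < m)%N) ->
  (forall k, fright (t i) k = zcell) ->
  runs (while_frag i (predC1 zcell) (op_frag i (fun _ => (zcell, MoveLeft))))
       t (upd t i (unary_ftape zcell ocell 0)).
Proof.
elim: m t => [|m IH] t hl hr.
  have hz k : fcons (fcur (t i)) (fleft (t i)) k = zcell.
    by apply/eqP; rewrite -[_ == _]negbK hl.
  have <- : t i = unary_ftape zcell ocell 0.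
    move: hz hr; case: (t i) => l c r /= hz hr; congr FTape; last exact/funext.
      by apply/funext => k; exact: (hz k.+1).
    exact: (hz 0%N).
  by rewrite upd_id; apply: runs_while_exit; rewrite /= (hz 0%N : fcur (t i) = zcell) eqxx.
have hc : fcur (t i) != zcell by rewrite (hl 0%N).
set t1 := upd t i (fact (zcell, MoveLeft) (t i)).
have t1i : t1 i = fact (zcell, MoveLeft) (t i) by rewrite /t1 upd_eq.
have := IH t1; rewrite {4}/t1 upd_upd => h.
apply: (runs_while_step hc (runs_op _ _ _)); apply: h; rewrite t1i.
- by move=> k; rewrite -[RHS](hl k.+1) /=; case: k.
- by move=> -[|k] /=.
Qed.

Lemma runs_erase (i : I) t : contiguous zcell (t i) ->
  runs (erase_frag i) t (upd t i (unary_ftape zcell ocell 0)).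
Proof.
move=> [a [b hab]].
apply: runs_seq; first exact: runs_op.
set t1 := upd _ _ _.
have t1i : t1 i = FTape (fleft (t i)) ocell (fright (t i)) by rewrite /t1 upd_eq.
have [||t2 h [hl hr]] := @runs_sweep_right i b.+1 a t1.
- by move=> k; rewrite t1i; have [] := hab k.
- by rewrite t1i => -[|k] //=; have [] := hab k.
apply: runs_seq; first exact: h.
apply: runs_seq; first exact: runs_op.
rewrite /t1 !upd_upd upd_eq; set t3 := upd _ _ _.
have -> : upd t i (unary_ftape zcell ocell 0) = upd t3 i (unary_ftape zcell ocell 0).
  by rewrite /t3 upd_upd.
apply: (@runs_sweep_left _ (a + b.+1)); rewrite /t3 upd_eq /=.
- by move=> k; rewrite -hl; case: k.
- exact: hr.
Qed.

Lemma runs_erase_all (s : seq I) t :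
  (forall i, i \in s -> contiguous zcell (t i)) ->
  runs (erase_all_frag s) t
    (fun i => if i \in s then unary_ftape zcell ocell 0 else t i).
Proof.
elim: s t => [|i s IH] t hs; first exact: runs_skip.
apply: runs_seq; first by apply: runs_erase; apply: hs; rewrite inE eqxx.
set t' := upd _ _ _.
have -> : (fun k => if k \in i :: s then unary_ftape zcell ocell 0 else t k) =
   (fun k => if k \in s then unary_ftape zcell ocell 0 else t' k).
  apply/funext => k; rewrite inE /t' /upd; case: eqP => //= _; by case: ifP.
apply: IH => k ks; rewrite /t' /upd; case: eqP => [_|_]; last first.
  by apply: hs; rewrite inE ks orbT.
by exists 0%N, 0%N => x.
Qed.

Lemma contiguous_unary n : contiguous zcell (unary_ftape zcell ocell n).
Proof.
by exists 0%N, n.-1 => k /=; split=> //; case: n => [|n] //; rewrite ltnS; case: ifP.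
Qed.

Lemma runs_read_output j (i r : I) m n t : i != r ->
  (forall k, dec_cell j (fcons (fcur (t i)) (fright (t i)) k) =
             if (k < m)%N then stroke (M j) else blank (M j)) ->
  contiguous zcell (t i) -> t r = unary_ftape zcell ocell n ->
  exists2 t', contiguous zcell t' &
    runs (while_frag i (fun g => dec_cell j g == stroke (M j))
           (seq_frag (op_frag i (fun g => (g, MoveRight))) (inc_frag ocell r)))
         t (upd (upd t i t') r (unary_ftape zcell ocell (n + m))).
Proof.
move=> ir; have ri : r != i by rewrite eq_sym.
elim: m n t => [|m IH] n t hd hC hr.
  exists (t i) => //; rewrite upd_id addn0 -hr upd_id; apply: runs_while_exit.
  by have /= -> := hd 0%N; rewrite eq_sym stroke_neq_blank.
have d0 : dec_cell j (fcur (t i)) == stroke (M j) by have /= -> := hd 0%N.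
(* A cell read as a stroke is not [zcell], whose decoding is the blank; moving over it therefore
   preserves contiguity. *)
have nz : fcur (t i) != zcell.
  apply: contraTneq d0 => ->.
  by rewrite eq_sym stroke_neq_blank.
pose t1 := upd (upd t i (fact (fcur (t i), MoveRight) (t i))) r
               (unary_ftape zcell ocell n.+1).
have t1i : t1 i = fact (fcur (t i), MoveRight) (t i).
  by rewrite /t1 upd_neq // upd_eq.
have [|||t' C' h] := IH n.+1 t1.
- by move=> k; rewrite t1i /= -[RHS]/(if (k.+1 < m.+1)%N then _ else _) -hd; case: k.
- by rewrite t1i; apply: contiguous_act.
- by rewrite /t1 upd_eq.
exists t' => //.
have -> : upd (upd t i t') r (unary_ftape zcell ocell (n + m.+1)) =
          upd (upd t1 i t') r (unary_ftape zcell ocell (n.+1 + m)).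
  by apply/funext => x; rewrite /t1 /upd addSnnS; case: eqP => // _; case: eqP.
apply: (runs_while_step d0 _ h); apply: runs_seq; first exact: runs_op.
by rewrite /t1; apply: (runs_inc ocell_neq); rewrite upd_neq.
Qed.

Lemma does_call (j : J) (r : 'I_K.+1) (v : I -> nat) :
  (forall x, v (inr x) = 0%N) ->
  does zcell ocell (call_frag j (inl r)) v (upd v (inl r) (f j (v (inl r)))).
Proof.
move=> v0; set i := @oracle_tape j ord0; set n := v (inl r).
have [T [c [hT hc [cl cr]]]] := Mf j n.
apply: runs_seq; first exact: (does_move ocell_neq).
rewrite v0 add0n -/n; set v1 := upd _ _ _.
have v1u x : v1 (oracle_tape x) = if x == ord0 :> 'I_(kk j).+1 then n else 0%N.
  rewrite /v1 upd_neq // /upd (inj_eq (@oracle_tape_inj j)) v0.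
  by case: eqP.
have [||t2 [h1 h2 h3 h4]] := @runs_machine_frag I cell _ (M j) _ (@oracle_tape_inj j)
   (@dec_cell j) (@enc_cell j) (@enc_cellK j) zcell (fun _ => isT) _ _ _ _
   (unaries zcell ocell v1) hT hc.
(* The decoded tapes form the initial configuration of [M j]: the argument is on its first tape and
   the other tapes are empty. *)
- move=> x; rewrite /unaries v1u.
  case: eqP => _; last by congr FTape; apply/funext => -[].
  case: (n) => [|m]; first by congr FTape; apply/funext => -[].
  congr FTape => /=; first by apply/funext => -[].
  by apply/funext => k; rewrite nth_nseq /= ltnS; case: ifP.
- by move=> x; apply: contiguous_unary.
apply: runs_seq; first exact: h1.
have t2r : t2 (inl r) = unary_ftape zcell ocell 0.
  by rewrite h4 // /unaries /v1 upd_eq.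
have [//||||t3 C3 h5] := @runs_read_output j i (inl r) (f j n) 0 t2.
- move=> k; rewrite -cr; have := h2 ord0; rewrite -/i.
  move=> /(congr1 (fun t => fcons (fcur t) (fright t) k)) /=.
  by case: k.
- exact: h3.
- exact: t2r.
apply: runs_seq; first exact: h5.
set t4 := upd _ _ _.
set s := [seq _ | _ <- _].
have -> : unaries zcell ocell (upd v (inl r) (f j n)) =
   (fun i => if i \in s then unary_ftape zcell ocell 0 else t4 i).
  apply/funext => x; case: ifPn => [/mapP[y _ ->]|xs].
    by rewrite /unaries upd_neq // v0.
  have nu (y : 'I_(kk j).+1) : oracle_tape y != x.
    apply: contraNneq xs => <-; by apply/mapP; exists y; rewrite ?mem_enum.
  rewrite /t4 /unaries /upd; case: eqP => [_|/eqP xr]; first by rewrite add0n.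
  rewrite eq_sym (negbTE (nu ord0)) h4 // /unaries /v1 /upd (negbTE xr).
  by rewrite eq_sym (negbTE (nu ord0)).
apply: runs_erase_all => x /mapP[y _ ->]; rewrite /t4 upd_neq //.
by rewrite /upd; case: eqP.
Qed.

End OracleCalls.

(** * Register programs and definable functions *)

(** An enumeration of [I] is corrected by the transposition that exchanges its first element with
    [i]. This puts a chosen register on the input tape. *)
Lemma ord_bijection (I : finType) (i : I) :
  exists k (e : 'I_k.+1 -> I) (e' : I -> 'I_k.+1),
    [/\ cancel e e', cancel e' e & e ord0 = i].
Proof.
have cI : #|I| = #|I|.-1.+1 by rewrite prednK //; apply/card_gt0P; exists i.
pose e0 (x : 'I_#|I|.-1.+1) : I := enum_val (cast_ord (esym cI) x).
pose e0' (y : I) := cast_ord cI (enum_rank y).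
have e0K : cancel e0 e0' by move=> x; rewrite /e0' enum_valK cast_ordKV.
have e0'K : cancel e0' e0 by move=> x; rewrite /e0 cast_ordK enum_rankK.
exists #|I|.-1, (fun x => tperm (e0 ord0) i (e0 x)),
  (fun y => e0' (tperm (e0 ord0) i y)); split=> [x|y|].
- by rewrite tpermK e0K.
- by rewrite e0'K tpermK.
- exact: tpermL.
Qed.

(** Primitive recursion with the index running downwards, in the order in which a loop decrements
    its counter. For sums, products and iterates the order does not matter. *)
Fixpoint count_down (g : nat -> nat -> nat) (n a : nat) : nat :=
  if n is n'.+1 then count_down g n' (g n' a) else a.

Section Definable.
Variables (J : finType) (kk : J -> nat) (M : forall j, machine (kk j).+1).
Variables (f : J -> nat -> nat) (Mf : forall j, computes (M j) (f j)).
Implicit Types (rho : nat -> nat) (F : seq nat -> nat).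

Notation tix := (tape_index kk).
Notation cmd K := (fragment (tix K) (cell M)).
Notation zc := (zcell M).
Notation oc := (ocell M).
Notation runsto := (does (zcell M) (ocell M)).

(** The tapes of the oracle machines are empty between calls. Only registers up to [K] are tapes,
    which is why statements about programs require [K] to be large. *)
Definition lift K rho : tix K -> nat :=
  fun i => if i is inl x then rho x else 0%N.

Definition reg K (r : nat) : tix K := inl (inord r).

Lemma lift_reg K rho r : (r <= K)%N -> lift rho (reg K r) = rho r.
Proof. by move=> rK; rewrite /lift /reg inordK. Qed.

Lemma lift_upd K rho r n : (r <= K)%N ->
  @lift K (upd rho r n) = upd (lift rho) (reg K r) n.
Proof.
move=> rK; apply/funext => -[x|x] //; rewrite /lift /upd /reg.
have -> : (inl x == inl (inord r) :> tix K) = (x == inord r) by [].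
by rewrite -val_eqE /= inordK.
Qed.

Lemma reg_neq K r s : (r <= K)%N -> (s <= K)%N -> r != s -> reg K r != reg K s.
Proof.
move=> rK sK; apply: contraNneq => -[/(congr1 val)]; rewrite /= !inordK // => ->.
exact: eqxx.
Qed.

(* The program [c rs b] leaves in register [b] the value of [F] at the contents
   of the registers [rs], using as working space the registers from [b] on. *)
Definition definable F : Prop :=
  exists c : seq nat -> nat -> forall K, cmd K,
  forall rs b, all (fun r => (r < b)%N) rs ->
  exists K0, forall K, (K0 <= K)%N -> forall rho,
    (forall i, (b <= i)%N -> rho i = 0%N) ->
    runsto (c rs b K) (lift rho) (lift (upd rho b (F (map rho rs)))).

Lemma definable_nth i : definable (fun v => nth 0%N v i).
Proof.
exists (fun rs b K => if (i < size rs)%N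
  then copy_frag zc oc (reg K (nth 0%N rs i)) (reg K b) (reg K b.+1)
  else skip_frag _ _) => rs b /all_nthP rsb.
exists b.+1 => K bK rho rho0; case: ltnP => ir; last first.
  by rewrite nth_default ?size_map // -(rho0 b) // upd_id; apply: does_skip.
have /= rb := rsb 0%N _ ir; set r := nth 0%N rs i in rb *.
rewrite (nth_map 0%N) // -/r lift_upd; last by lia.
have -> : rho r = (lift rho (reg K b) + lift rho (reg K r))%N.
  by rewrite !lift_reg ?(rho0 b) //; lia.
by apply: does_copy; [exact: ocell_neq|apply: reg_neq; lia..|rewrite lift_reg ?(rho0 b.+1) //; lia].
Qed.

Lemma definable0 : definable (fun _ => 0%N).
Proof.
exists (fun _ _ K => skip_frag _ _) => rs b _; exists 0%N => K _ rho rho0.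
by rewrite -(rho0 b) // upd_id; apply: does_skip.
Qed.

Lemma definableS F : definable F -> definable (fun v => (F v).+1).
Proof.
move=> [c hc]; exists (fun rs b K => seq_frag (c rs b K) (inc_frag oc (reg K b))).
move=> rs b rsb; have [K0 hK] := hc _ _ rsb.
exists (maxn K0 b) => K; rewrite geq_max => /andP[K0K bK] rho rho0.
apply: does_seq; first exact: hK.
have := @does_inc _ _ zc oc (ocell_neq M) (reg K b) (lift (upd rho b (F (map rho rs)))).
by rewrite lift_reg // -lift_upd // upd_upd upd_eq.
Qed.

Lemma definable_oracle j F : definable F -> definable (fun v => f j (F v)).
Proof.
move=> [c hc]; exists (fun rs b K => seq_frag (c rs b K) (call_frag M j (reg K b))).
move=> rs b rsb; have [K0 hK] := hc _ _ rsb.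
exists (maxn K0 b) => K; rewrite geq_max => /andP[K0K bK] rho rho0.
apply: does_seq; first exact: hK.
set rho1 := upd _ _ _.
have := @does_call J kk M f Mf K j (inord b) (lift rho1) (fun _ => erefl).
by rewrite -/(reg K b) lift_reg // -lift_upd // /rho1 upd_upd upd_eq.
Qed.

Lemma definable_take n F : definable F -> definable (fun v => F (take n v)).
Proof.
move=> [c hc]; exists (fun rs => c (take n rs)) => rs b rsb.
have [|K0 hK] := hc (take n rs) b.
  by apply/allP => x /mem_take xr; exact: (allP rsb).
by exists K0 => K /hK h rho /h; rewrite map_take.
Qed.

Lemma definable_drop n F : definable F -> definable (fun v => F (drop n v)).
Proof.
move=> [c hc]; exists (fun rs => c (drop n rs)) => rs b rsb.
have [|K0 hK] := hc (drop n rs) b.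
  by apply/allP => x /mem_drop xr; exact: (allP rsb).
by exists K0 => K /hK h rho /h; rewrite map_drop.
Qed.

(** Discards an auxiliary value in register [b] and puts the result computed just above in its
    place. *)
Definition pop_frag K b : cmd K :=
  seq_frag (clear_frag zc oc (reg K b)) (move_frag zc oc (reg K b.+1) (reg K b)).

Lemma does_pop K b rho : (b < K)%N ->
  runsto (pop_frag K b) (lift rho) (lift (upd (upd rho b (rho b.+1)) b.+1 0%N)).
Proof.
move=> bK; apply: does_seq; first exact: (does_clear (ocell_neq M)).
rewrite -lift_upd; last exact: ltnW.
set rho1 := upd rho _ _.
have := @does_move _ _ zc oc (ocell_neq M) (reg K b.+1) (reg K b) (lift rho1).
rewrite !lift_reg //; last exact: ltnW.
rewrite -!lift_upd //; last exact: ltnW.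
have -> : (rho1 b + rho1 b.+1 = rho b.+1)%N.
  by rewrite /rho1 upd_eq upd_neq //; lia.
by rewrite /rho1 upd_upd; apply; apply: reg_neq; lia.
Qed.

Lemma map_upd rho b x (rs : seq nat) : all (fun r => (r < b)%N) rs ->
  map (upd rho b x) rs = map rho rs.
Proof.
by move=> /allP rsb; apply/eq_in_map => r /rsb rb; rewrite upd_neq //; lia.
Qed.

(** Register [b] keeps the value of [G] as an additional argument while [F] works from [b.+1] on;
    the final pop moves the result down to [b]. *)
Lemma definable_let G F : definable G -> definable F ->
  definable (fun v => F (G v :: v)).
Proof.
move=> [cG hG] [cF hF].
exists (fun rs b K => seq_frag (cG rs b K)
          (seq_frag (cF (b :: rs) b.+1 K) (pop_frag K b))).
move=> rs b rsb; have [K1 h1] := hG _ _ rsb.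
have rsb' : all (fun r => (r < b.+1)%N) (b :: rs).
  by rewrite /= leqnn; apply/allP => r /(allP rsb) /ltnW.
have [K2 h2] := hF _ _ rsb'.
exists (maxn b.+1 (maxn K1 K2)) => K; rewrite !geq_max => /and3P[bK K1K K2K] rho rho0.
apply: does_seq; first exact: h1.
apply: does_seq; first apply: h2 => //.
  by move=> i bi; rewrite upd_neq; [apply: rho0; lia|lia].
have := does_pop (upd (upd rho b (G (map rho rs))) b.+1
    (F (map (upd rho b (G (map rho rs))) (b :: rs)))) bK.
congr (runsto _ _ (lift _)); rewrite /= upd_eq map_upd //.
apply/funext => i; rewrite /upd eqxx.
case: (eqVneq i b.+1) => [->|_]; last by case: eqP.
by case: eqP => [|_]; [lia|rewrite rho0].
Qed.

(** Register [b] is the counter and [b.+1] the accumulator. Each round computes the new accumulator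
    in [b.+2] and pops it; the last pop replaces the exhausted counter by the result. *)
Lemma definable_count_down B Z S : definable B -> definable Z -> definable S ->
  definable (fun v => count_down (fun n a => S [:: a, n & v]) (B v) (Z v)).
Proof.
move=> [cB hB] [cZ hZ] [cS hS].
exists (fun rs b K => seq_frag (cB rs b K) (seq_frag (cZ rs b.+1 K)
  (seq_frag (loop_frag oc (reg K b) (seq_frag (dec_frag zc (reg K b))
     (seq_frag (cS [:: b.+1, b & rs] b.+2 K) (pop_frag K b.+1))))
   (pop_frag K b)))).
move=> rs b rsb; have [K1 h1] := hB _ _ rsb.
have rsb1 : all (fun r => (r < b.+1)%N) rs by apply/allP => r /(allP rsb) /ltnW.
have [K2 h2] := hZ _ _ rsb1.
have rsb2 : all (fun r => (r < b.+2)%N) [:: b.+1, b & rs].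
  by rewrite /= leqnn ltnS leqnSn; apply/allP => r /(allP rsb1) /ltnW.
have [K3 h3] := hS _ _ rsb2.
exists (maxn b.+2 (maxn K1 (maxn K2 K3))) => K.
rewrite !geq_max => /and4P[bK K1K K2K K3K] rho rho0.
apply: does_seq; first exact: h1.
apply: does_seq; first apply: h2 => //.
  by move=> i bi; rewrite upd_neq; [apply: rho0; lia|lia].
rewrite map_upd //; move: (B _) (Z _) => n a.
pose st n a := upd (upd rho b n) b.+1 a.
have st_b m x : st m x b = m by rewrite /st upd_neq ?upd_eq //; lia.
have st_b1 m x : st m x b.+1 = x by rewrite /st upd_eq.
have st_rs m x : map (st m x) rs = map rho rs by rewrite /st !map_upd.
apply: (@does_seq _ _ _ _ _ _ _ (lift (st 0%N
    (count_down (fun n a => S [:: a, n & map rho rs]) n a)))); last first.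
  have := @does_pop K b (st 0%N (count_down (fun n a => S [:: a, n & map rho rs]) n a)) (ltnW bK).
  congr (runsto _ _ (lift _)); rewrite st_b1.
  apply/funext => i; rewrite /st /upd.
  case: (eqVneq i b.+1) => [->|_]; last by case: eqP.
  by case: eqP => [|_]; [lia|rewrite rho0].
rewrite -/(st n a); elim: n a => [|n IH] a.
  by apply: (does_loop_exit (ocell_neq M)); rewrite lift_reg ?st_b //; lia.
apply: (does_loop_step (ocell_neq M) _ _ (IH _)).
  by rewrite lift_reg ?st_b //; lia.
apply: does_seq; first exact: does_dec.
rewrite lift_reg ?st_b /=; last by lia.
rewrite -lift_upd; last by lia.
have -> : upd (st n.+1 a) b n = st n a.
  apply/funext => i; rewrite /st /upd; case: (eqVneq i b) => [->|//].
  by case: eqP => //; lia.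
apply: does_seq; first apply: h3 => //.
  move=> i bi; rewrite /st !upd_neq; [apply: rho0; lia|lia|lia].
rewrite /= st_b st_b1 st_rs; set y := S _.
have := @does_pop K b.+1 (upd (st n a) b.+2 y) bK.
congr (runsto _ _ (lift _)); rewrite upd_eq.
apply/funext => i; rewrite /st /upd.
case: (eqVneq i b.+2) => [->|_]; last by case: eqP.
by do 2![case: eqP => [|_]; first by lia]; rewrite rho0 //; lia.
Qed.

Lemma definable_recursive F : definable F -> recursive (fun n => F [:: n]).
Proof.
move=> [c hc]; have [//|K0 hK] := hc [:: 0%N] 1%N.
pose K := maxn K0 1; have K0K : (K0 <= K)%N by rewrite leq_maxl.
have K1 : (1 <= K)%N by rewrite leq_maxr.
have [k [e [e' [eK e'K e0]]]] := ord_bijection (reg K 0).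
(* The input is in register 0 and the work space starts at register 1; the pop carries the result
   back to register 0, the output tape. *)
pose P := seq_frag (c [:: 0%N] 1%N K) (pop_frag K 0).
exists k, (fragment_machine P (ocell_neq M) e e') => n.
pose rho := upd (fun _ => 0%N) 0%N n.
pose rho' := upd (fun _ => 0%N) 0%N (F [:: n]).
have hP : runsto P (lift rho) (lift rho').
  apply: does_seq; first apply: hK => //.
    by move=> i i1; rewrite /rho upd_neq //; lia.
  have := @does_pop K 0%N (upd rho 1%N (F (map rho [:: 0%N]))) K1.
  congr (runsto _ _ (lift _)); rewrite /= /rho !upd_eq.
  by apply/funext => -[|[]].
pose tp (i : 'I_k.+1) := unary_tape (fragment_machine P (ocell_neq M) e e')
                 (if i == ord0 then n else 0%N).
have tpE x : ftape_of zc (tp x) = unaries zc oc (lift rho) (e x).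
  rewrite /tp /unaries.
  have -> : lift rho (e x) = (if x == ord0 then n else 0%N).
    case: eqP => [->|/eqP x0]; first by rewrite e0 lift_reg.
    have : e x != reg K 0 by rewrite -e0 (can_eq eK).
    case: (e x) => //= y; rewrite /reg => y0; rewrite /rho upd_neq //.
    apply: contraNneq y0 => y0; apply/eqP; congr inl; apply: val_inj.
    by rewrite /= inordK.
  case: (if _ then _ else _) => [|m]; congr FTape => /=; try by apply/funext => -[].
  by apply/funext => i; rewrite nth_nseq /= ltnS; case: ifP.
have [T [tp' [hT tp'E]]] :=
  steps_fragment_machine (ocell_neq M) e'K hP tpE.
exists T, (None, tp'); split=> //.
have := tp'E ord0; rewrite e0 /unaries lift_reg // /rho' upd_eq /ftape_of /=.
move=> [hl hcur hr]; split=> /=.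
  by apply/(all_nthP zc) => i _; rewrite hl /= eqxx.
by move=> [|i] /=; rewrite ?hcur ?hr.
Qed.

End Definable.

(** * Primitive recursive arithmetic *)

Lemma count_down_sum g n a :
  count_down (fun i x => x + g i)%N n a = (a + \sum_(i < n) g i)%N.
Proof.
elim: n a => [|n IH] a /=; first by rewrite big_ord0 addn0.
by rewrite IH big_ord_recr /= addnAC addnA.
Qed.

Lemma count_down_prod g n a :
  count_down (fun i x => x * g i)%N n a = (a * \prod_(i < n) g i)%N.
Proof.
elim: n a => [|n IH] a /=; first by rewrite big_ord0 muln1.
by rewrite IH big_ord_recr /= mulnAC mulnA.
Qed.

Lemma count_down_iter g n a : count_down (fun _ => g) n a = iter n g a.
Proof. by elim: n a => //= n IH a; rewrite IH -iterSr. Qed.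

(** * Closure of the definable functions under arithmetic operations *)

Section DefinableArithmetic.
Variables (J : finType) (kk : J -> nat) (M : forall j, machine (kk j).+1).
Implicit Types F G : seq nat -> nat.
Notation D := (definable M).

Lemma eq_definable F G : F =1 G -> D F -> D G.
Proof. by move=> /funext ->. Qed.

Lemma definable_const n : D (fun _ => n).
Proof. by elim: n => [|n IH]; [exact: definable0|exact: definableS]. Qed.

Lemma definable_comp F G : D F -> D G -> D (fun v => F [:: G v]).
Proof.
move=> hF hG; apply: eq_definable (definable_let hG (definable_take 1 hF)) => v.
by rewrite /= take0.
Qed.

(** The recursion step sees the list [[:: a, i & v]]; dropping the accumulator [a] leaves the
    arguments of [F]. The addition itself is an iterated successor. *)
Lemma definable_sum F B : D F -> D B -> D (fun v => \sum_(i < B v) F (nat_of_ord i :: v))%N.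
Proof.
move=> hF hB.
suff hadd : D (fun w => nth 0 w 0 + F (drop 1 w))%N.
  apply: eq_definable (definable_count_down hB (definable0 _) hadd) => v /=.
  by rewrite -[RHS]add0n -(count_down_sum (fun i => F (i :: v))); congr count_down;
     apply/funext => n; apply/funext => a; rewrite drop0.
have := definable_count_down (definable_drop 1 hF) (definable_nth M 0)
  (definableS (definable_nth M 0)).
by apply: eq_definable => v /=; rewrite count_down_iter iter_succn.
Qed.

Lemma definable_add F G : D F -> D G -> D (fun v => F v + G v)%N.
Proof.
move=> hF hG; have := definable_count_down hG hF (definableS (definable_nth M 0)).
by apply: eq_definable => v /=; rewrite count_down_iter iter_succn.
Qed.

Lemma definable_mul F G : D F -> D G -> D (fun v => F v * G v)%N.
Proof.
move=> hF hG; have := definable_sum (definable_drop 1 hF) hG.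
by apply: eq_definable => v /=; rewrite drop0 sum_nat_const card_ord mulnC.
Qed.

Lemma definable_prod F B : D F -> D B -> D (fun v => \prod_(i < B v) F (nat_of_ord i :: v))%N.
Proof.
move=> hF hB.
have := definable_count_down hB (definable_const 1)
  (definable_mul (definable_nth M 0) (definable_drop 1 hF)).
apply: eq_definable => v /=; rewrite -[RHS]mul1n -(count_down_prod (fun i => F (i :: v))).
by congr count_down; apply/funext => n; apply/funext => a; rewrite drop0.
Qed.

Lemma definable_iter F B Z : D F -> D B -> D Z ->
  D (fun v => iter (B v) (fun a => F [:: a]) (Z v)).
Proof.
move=> hF hB hZ; have := definable_count_down hB hZ (definable_take 1 hF).
apply: eq_definable => v; rewrite -(count_down_iter (fun a => F [:: a])).
by congr count_down; apply/funext => n; apply/funext => a; rewrite /= take0.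
Qed.

(** The predecessor of n is the number of nonzero i < n, a bounded sum. *)
Lemma definable_pred F : D F -> D (fun v => (F v).-1).
Proof.
move=> hF; have hs : D (fun w => nth 0 w 0 != 0)%N.
  have := definable_count_down (definable_nth M 0) (definable0 M) (definable_const 1).
  apply: eq_definable => v; rewrite count_down_iter.
  by case: (nth _ _ _) => //= n; elim: n.
apply: eq_definable (definable_sum hs hF) => v /=.
case: (F v) => [|n]; first by rewrite big_ord0.
by rewrite big_ord_recl /= (eq_bigr (fun=> 1%N)) // sum1_card card_ord.
Qed.

Lemma definable_sub F G : D F -> D G -> D (fun v => F v - G v)%N.
Proof.
move=> hF hG.
have := definable_iter (definable_pred (definable_nth M 0)) hG hF.
by apply: eq_definable => v /=; elim: (G v) => [|n IH]; rewrite ?subn0 //= IH subnS.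
Qed.

Lemma definable_leq F G : D F -> D G -> D (fun v => F v <= G v)%N.
Proof.
move=> hF hG; have := definable_sub (definable_const 1) (definable_sub hF hG).
by apply: eq_definable => v /=; case: leqP; lia.
Qed.

Lemma definable_minn F G : D F -> D G -> D (fun v => minn (F v) (G v)).
Proof.
move=> hF hG; have := definable_sub hF (definable_sub hF hG).
by apply: eq_definable => v; rewrite minnE.
Qed.

Lemma definable_if (b : seq nat -> bool) F G :
  D (fun v => b v) -> D F -> D G -> D (fun v => if b v then F v else G v).
Proof.
move=> hb hF hG; have := definable_add (definable_mul hb hF)
  (definable_mul (definable_sub (definable_const 1) hb) hG).
by apply: eq_definable => v /=; case: (b v); lia.
Qed.

Lemma definable_odd F : D F -> D (fun v => odd (F v)).
Proof.
move=> hF.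
have := definable_iter (definable_sub (definable_const 1) (definable_nth M 0)) hF
   (definable_const 0).
by apply: eq_definable => v /=; elim: (F v) => [|n IH] //=; rewrite IH; case: (odd n).
Qed.

(** Half of n, rounded down, is the number of odd i < n. *)
Lemma definable_half F : D F -> D (fun v => (F v)./2).
Proof.
move=> hF; have := definable_sum (definable_odd (definable_nth M 0)) hF.
apply: eq_definable => v /=; elim: (F v) => [|n IH]; first by rewrite big_ord0.
by rewrite big_ord_recr /= IH uphalf_half addnC.
Qed.

Lemma cantor_to_natE x y :
  Cantor.to_nat (x, y) = (y + \sum_(i < y + x) i.+1)%N.
Proof.
rewrite /Cantor.to_nat plusE; congr addn.
elim: (y + x)%N => [|n IH] /=; first by rewrite big_ord0.
by rewrite IH big_ord_recr /=; lia.
Qed.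

Lemma definable_pair F G : D F -> D G -> D (fun v => Cantor.to_nat (F v, G v)).
Proof.
move=> hF hG; have := definable_add hG
  (definable_sum (definableS (definable_nth M 0)) (definable_add hG hF)).
by apply: eq_definable => v; rewrite cantor_to_natE.
Qed.

(** The index of the largest triangular number not above n, written as a count of the positive ones
    so that it is a bounded sum. *)
Definition triangle_root n := (\sum_(i < n) (\sum_(k < i.+1) k.+1 <= n))%N.

(** With t = x + y, the code is y plus the t-th triangular number; as y <= t, it stays below the
    next triangular number, so exactly t positive ones are counted. *)
Lemma triangle_rootE x y : triangle_root (Cantor.to_nat (x, y)) = (y + x)%N.
Proof.
rewrite cantor_to_natE; set t := (y + x)%N; set m := (y + _)%N.
have tri_mono i j : (i <= j)%N -> (\sum_(k < i) k.+1 <= \sum_(k < j) k.+1)%N.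
  move=> ij; rewrite -(subnKC ij) big_split_ord /= leq_addr //.
have tri_ge i : (i <= \sum_(k < i) k.+1)%N.
  by rewrite -{1}[i]card_ord -sum1_card leq_sum.
have tm : (t <= m)%N by rewrite /m (leq_trans (tri_ge t)) // leq_addl.
rewrite /triangle_root (eq_bigr (fun i : 'I_m => nat_of_bool (i < t)%N)); last first.
  move=> i _; congr nat_of_bool; apply/idP/idP => [h|it].
    rewrite ltnNge; apply/negP => ti.
    have := leq_trans (tri_mono t.+1 i.+1 ti) h.
    by rewrite big_ord_recr /= /m addnC leq_add2r /t; lia.
  by apply: leq_trans (tri_mono _ _ it) _; rewrite /m leq_addl.
rewrite -(subnKC tm) big_split_ord /= [X in (X + _)%N](eq_bigr (fun=> 1%N)); last first.
  by move=> i _; rewrite ltn_ord.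
rewrite sum1_card card_ord big1 ?addn0 // => i _.
by rewrite ltnNge leq_addr.
Qed.

Lemma definable_triangle_root F : D F -> D (fun v => triangle_root (F v)).
Proof.
move=> hF.
have h : D (fun w => triangle_root (nth 0 w 0)%N).
  apply: (definable_sum _ (definable_nth M 0)
    (F := fun v => (\sum_(k < (nth 0 v 0).+1) k.+1 <= nth 0 v 1)%N)).
  apply: definable_leq (definable_nth _ _).
  apply: (definable_sum (F := fun v => (nth 0 v 0).+1) (B := fun v => (nth 0 v 0).+1)%N).
    exact/definableS/definable_nth.
  exact/definableS/definable_nth.
exact: (definable_comp h hF).
Qed.

Lemma cantor_snd n : (Cantor.of_nat n).2 = (n - \sum_(i < triangle_root n) i.+1)%N.
Proof.
rewrite -(Cantor.cancel_to_of n); case: (Cantor.of_nat n) => x y.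
by rewrite Cantor.cancel_of_to triangle_rootE cantor_to_natE addnK.
Qed.

Lemma cantor_fst n : (Cantor.of_nat n).1 = (triangle_root n - (Cantor.of_nat n).2)%N.
Proof.
rewrite -(Cantor.cancel_to_of n); case: (Cantor.of_nat n) => x y.
by rewrite Cantor.cancel_of_to triangle_rootE /= addKn.
Qed.

Lemma definable_snd F : D F -> D (fun v => (Cantor.of_nat (F v)).2).
Proof.
move=> hF; have := definable_sub hF
  (definable_sum (definableS (definable_nth M 0)) (definable_triangle_root hF)).
by apply: eq_definable => v /=; rewrite cantor_snd.
Qed.

Lemma definable_fst F : D F -> D (fun v => (Cantor.of_nat (F v)).1).
Proof.
move=> hF; have := definable_sub (definable_triangle_root hF) (definable_snd hF).
by apply: eq_definable => v /=; rewrite cantor_fst.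
Qed.

End DefinableArithmetic.

(** * Situations and rational capital *)

(** Definability is relative to one family of machines, so the machines of all the functions in use
    are gathered into a single finite family. *)
Lemma recursive_oracles (fs : seq (nat -> nat)) :
  (forall i, (i < size fs)%N -> recursive (nth id fs i)) ->
  exists (J : finType) (kk : J -> nat) (M : forall j, machine (kk j).+1),
  forall i, (i < size fs)%N -> definable M (fun v => nth id fs i (nth 0 v 0)%N).
Proof.
move=> rfs.
have [|g gP] := @choice 'I_(size fs) {k & machine k.+1}
    (fun j g => computes (projT2 g) (nth id fs j)).
  by move=> j; have [k [M hM]] := rfs j (ltn_ord j); exists (existT _ k M).
exists 'I_(size fs), (fun j => projT1 (g j)), (fun j => projT2 (g j)) => i ifs.
exact: (definable_oracle gP (Ordinal ifs) (definable_nth _ 0)).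
Qed.

Lemma situation_code_rcons s x :
  situation_code (rcons s x) = ((situation_code s).*2 + x.+1)%N.
Proof. by rewrite /situation_code foldl_rcons. Qed.

Lemma leq_size_situation_code s : (size s <= situation_code s)%N.
Proof.
elim/last_ind: s => // s x IH; rewrite situation_code_rcons size_rcons.
by rewrite -addnn; lia.
Qed.

(** Removes the last entry: a code 2c + x + 1 is sent to c. The empty situation, of code 0, is its
    own parent. *)
Definition parent_code c := (c.-1)./2.

(** Counts the non-empty ancestors, the situation included; the bound [c] suffices because a
    situation is no longer than its code. *)
Definition code_length c := (\sum_(i < c) (iter i parent_code c != 0))%N.

Definition prefix_code c k := iter (code_length c - k) parent_code c.

Lemma iter_parent_code s i :
  iter i parent_code (situation_code s) = situation_code (take (size s - i) s).
Proof.
elim: i => [|i IH] /=; first by rewrite subn0 take_size.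
rewrite IH; case e : (size s - i)%N => [|j].
  by rewrite (_ : size s - i.+1 = 0)%N ?take0 //; lia.
rewrite (_ : size s - i.+1 = j)%N; last by lia.
rewrite (take_nth false); last by lia.
rewrite situation_code_rcons /parent_code addnS /= addnC.
by rewrite half_bit_double.
Qed.

Lemma code_lengthE s : code_length (situation_code s) = size s.
Proof.
have sm := leq_size_situation_code s; rewrite /code_length.
rewrite (eq_bigr (fun i : 'I__ => nat_of_bool (i < size s)%N)); last first.
  move=> i _; rewrite iter_parent_code; congr nat_of_bool.
  apply/idP/idP => [|ilt].
    apply: contraNT; rewrite -leqNgt => si.
    by rewrite (eqP (_ : size s - i == 0))%N // ?take0.
  rewrite -lt0n; apply: leq_trans (leq_size_situation_code _).
  by rewrite size_take; case: ifP; lia.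
rewrite -(subnKC sm) big_split_ord /= [X in (X + _)%N](eq_bigr (fun=> 1%N)); last first.
  by move=> i _; rewrite ltn_ord.
rewrite sum1_card card_ord big1 ?addn0 // => i _.
by rewrite ltnNge leq_addr.
Qed.

Lemma prefix_codeE s k : (k <= size s)%N ->
  prefix_code (situation_code s) k = situation_code (take k s).
Proof. by move=> ks; rewrite /prefix_code code_lengthE iter_parent_code subKn. Qed.

(** The code 2c + x + 1 of a prefix is even exactly when its last entry x is 1. *)
Lemma odd_prefix_code s k : (k < size s)%N ->
  ~~ odd (prefix_code (situation_code s) k.+1) = nth false s k.
Proof.
move=> ks; rewrite prefix_codeE // (take_nth false) // situation_code_rcons.
by rewrite oddD odd_double /= negbK; case: nth.
Qed.

(** * Recursive rational approximations of the capital *)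

Section RationalCapital.
Variables (sg num den ee : nat -> nat) (sigma : nat -> bool) (K : nat) (b : bool).

(* With approximations clamped to [0, 1] the rational capital stays positive. *)
Definition clamped_num (p : nat) : nat :=
  if odd (sg p) then 0%N else minn (num p) (den p).

(** Numerator of $1 \pm (q/d - x)/K$ over the denominator $Kd$, with a minus sign when [b] holds.
    For $K > 1$ the natural subtraction is exact, since $q \le d$ and $x \le 1$. *)
Definition bet_num (x : bool) (k p : nat) : nat :=
  if sigma k then
    if b then K * den p + x * den p - clamped_num p
    else K * den p + clamped_num p - x * den p
  else 1.

Definition bet_den (k p : nat) : nat := if sigma k then K * den p else 1.

Definition capital_num (c n : nat) : nat :=
  \prod_(k < code_length c)
     bet_num (~~ odd (prefix_code c k.+1)) k (Cantor.to_nat (prefix_code c k, n)).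

Definition capital_den (c n : nat) : nat :=
  \prod_(k < code_length c) bet_den k (Cantor.to_nat (prefix_code c k, n)).

(* An error [e] in each forecast makes an error of at most [4 ^ size s * e] in
   the capital, whence the summand [2 * size s]; a sum serves as a maximum. *)
Definition capital_modulus (c N : nat) : nat :=
  \sum_(k < (code_length c).+1)
     ee (Cantor.to_nat (prefix_code c k, N + (code_length c).*2)).

Hypotheses (rsg : recursive sg) (rnum : recursive num) (rden : recursive den).
Hypotheses (ree : recursive ee) (rsigma : recursive_selection sigma).

Section WithOracles.
Variables (J : finType) (kk : J -> nat) (M : forall j, machine (kk j).+1).
Notation D := (definable M).
Hypotheses (Dsg : D (fun v => sg (nth 0 v 0)%N)) (Dnum : D (fun v => num (nth 0 v 0)%N))
  (Dden : D (fun v => den (nth 0 v 0)%N)) (Dee : D (fun v => ee (nth 0 v 0)%N))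
  (Dsigma : D (fun v => sigma (nth 0 v 0)%N)).

Lemma definable_code_length F : D F -> D (fun v => code_length (F v)).
Proof.
move=> hF.
have hpar := definable_half (definable_pred (definable_nth M 0)).
have h : D (fun v => code_length (nth 0 v 0)%N).
  apply: (definable_sum (F := fun v => iter (nth 0 v 0)%N parent_code (nth 0 v 1)%N != 0%N)
    _ (definable_nth M 0)).
  have := definable_leq (definable_const M 1)
    (definable_iter hpar (definable_nth M 0) (definable_nth M 1)).
  by apply: eq_definable => v; rewrite lt0n.
exact: (definable_comp h hF).
Qed.

Lemma definable_prefix_code F G : D F -> D G -> D (fun v => prefix_code (F v) (G v)).
Proof.
move=> hF hG; exact: (definable_iter
  (definable_half (definable_pred (definable_nth M 0)))
  (definable_sub (definable_code_length hF) hG) hF).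
Qed.

Lemma definable_clamped_num F : D F -> D (fun v => clamped_num (F v)).
Proof.
move=> hF; rewrite /clamped_num; apply: definable_if.
- exact: definable_odd (definable_comp Dsg hF).
- exact: definable_const.
- exact: definable_minn (definable_comp Dnum hF) (definable_comp Dden hF).
Qed.

Lemma definable_bet_num (x : seq nat -> bool) F G : D (fun v => x v) -> D F -> D G ->
  D (fun v => bet_num (x v) (F v) (G v)).
Proof.
move=> hx hF hG; rewrite /bet_num; apply: definable_if; last exact: definable_const.
  exact: (definable_comp Dsigma hF).
have hd := definable_comp Dden hG; have hKd := definable_mul (definable_const M K) hd.
have hxd := definable_mul hx hd; have hq := definable_clamped_num hG.
case: b; first exact: definable_sub (definable_add hKd hxd) hq.
exact: definable_sub (definable_add hKd hq) hxd.
Qed.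

Lemma definable_bet_den F G : D F -> D G -> D (fun v => bet_den (F v) (G v)).
Proof.
move=> hF hG; rewrite /bet_den; apply: definable_if; last exact: definable_const.
  exact: (definable_comp Dsigma hF).
exact: definable_mul (definable_const M K) (definable_comp Dden hG).
Qed.

Let Dfst := definable_fst (definable_nth M 0).
Let Dsnd := definable_snd (definable_nth M 0).
(** Under a bounded sum or product the index becomes argument 0, and the encoded pair argument 1. *)
Let Dfst1 := definable_fst (definable_nth M 1).
Let Dsnd1 := definable_snd (definable_nth M 1).

Let Dprefix := definable_prefix_code Dfst1 (definable_nth M 0).

Lemma definable_capital_num :
  D (fun v => let p := Cantor.of_nat (nth 0 v 0)%N in capital_num p.1 p.2).
Proof.
have hx := definable_odd (definable_prefix_code Dfst1 (definableS (definable_nth M 0))).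
have {}hx : D (fun w => ~~ odd (prefix_code (Cantor.of_nat (nth 0 w 1)%N).1 (nth 0 w 0)%N.+1)).
  by apply: eq_definable (definable_sub (definable_const M 1) hx) => v; case: odd.
exact: (definable_prod (definable_bet_num hx (definable_nth M 0)
  (definable_pair Dprefix Dsnd1)) (definable_code_length Dfst)).
Qed.

Lemma definable_capital_den :
  D (fun v => let p := Cantor.of_nat (nth 0 v 0)%N in capital_den p.1 p.2).
Proof.
exact: (definable_prod (definable_bet_den (definable_nth M 0)
  (definable_pair Dprefix Dsnd1)) (definable_code_length Dfst)).
Qed.

Lemma definable_capital_modulus :
  D (fun v => let p := Cantor.of_nat (nth 0 v 0)%N in capital_modulus p.1 p.2).
Proof.
have hl := definable_code_length Dfst1.
have hN : D (fun w => let p := Cantor.of_nat (nth 0 w 1)%N in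
    p.2 + (code_length p.1).*2)%N.
  by apply: eq_definable (definable_add Dsnd1 (definable_add hl hl)) => v; rewrite addnn.
exact: (definable_sum (definable_comp Dee (definable_pair Dprefix hN))
  (definableS (definable_code_length Dfst))).
Qed.

End WithOracles.

Lemma recursive_capital :
  [/\ recursive (fun m => let p := Cantor.of_nat m in capital_num p.1 p.2),
      recursive (fun m => let p := Cantor.of_nat m in capital_den p.1 p.2) &
      recursive (fun m => let p := Cantor.of_nat m in capital_modulus p.1 p.2)].
Proof.
have [|J [kk [M hM]]] :=
  recursive_oracles (fs := [:: sg; num; den; ee; (fun k => nat_of_bool (sigma k))]).
  by do 5![case=> //].
have [Dsg Dnum Dden] := And3 (hM 0 isT) (hM 1 isT) (hM 2 isT).
have [Dee Dsigma] := conj (hM 3 isT) (hM 4 isT).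
split.
- exact: (definable_recursive (definable_capital_num Dsg Dnum Dden Dsigma)).
- exact: (definable_recursive (definable_capital_den Dden Dsigma)).
- exact: (definable_recursive (definable_capital_modulus Dee)).
Qed.

End RationalCapital.

Lemma recursive_const n : recursive (fun _ => n).
Proof.
have [//|J [kk [M _]]] := recursive_oracles (fs := [::]).
exact: (definable_recursive (definable_const M n)).
Qed.

Lemma recursive_partial_sum (g : nat -> nat) : recursive g ->
  recursive (fun n => \sum_(k < n) g k)%N.
Proof.
move=> rg; have [|J [kk [M hM]]] := recursive_oracles (fs := [:: g]); first by case.
exact: (definable_recursive (definable_sum (hM 0 isT) (definable_nth M 0))).
Qed.

(** * The capital process *)

Local Open Scope classical_set_scope.
Local Open Scope ring_scope.

Section Capital.
Context {R : realType}.
Variables (sigma : nat -> bool) (K : nat) (b : bool).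
Hypothesis K2 : (1 < K)%N.
Implicit Types (P Q : situation -> R) (s : situation).

(** The stake pays P - x when [b] is false and x - P when [b] is true; with P the lower,
    respectively the upper, end point, no admissible expectation of it is positive. *)
Definition bet P s (x : bool) : R :=
  if sigma (size s) then (-1) ^+ b * (P s - x%:R) / K%:R else 0.

Definition capital P s : R :=
  \prod_(k < size s) (1 + bet P (take k s) (nth false s k)).

Definition unit_valued P := forall s, 0 <= P s <= 1.

Lemma capital_rcons P s x : capital P (rcons s x) = capital P s * (1 + bet P s x).
Proof.
rewrite /capital size_rcons big_ord_recr /= nth_rcons ltnn eqxx.
rewrite -cats1 take_size_cat //; congr (_ * _).
by apply: eq_bigr => i _; rewrite takel_cat 1?ltnW // nth_cat ltn_ord.
Qed.

Lemma capital_initial_segment P (omega : binary_path) n :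
  capital P (initial_segment omega n) =
  \prod_(k < n) (1 + bet P (initial_segment omega k) (omega k)).
Proof.
rewrite /capital size_mkseq; apply: eq_bigr => k _.
by rewrite nth_mkseq // /initial_segment /mkseq -map_take take_iota (minn_idPl _) // ltnW.
Qed.

(** A fraction 1/K <= 1/2 is staked on a gain of absolute value at most 1. This keeps the capital
    positive and the bets in the range of the exponential estimate. *)
Lemma normr_bet_le P s x : unit_valued P -> `|bet P s x| <= 2^-1.
Proof.
move=> /(_ s)/andP[P0 P1]; rewrite /bet; case: ifP => _; last by rewrite normr0.
rewrite !normrM normrX normrN1 expr1n mul1r.
have K0 : 2 <= K%:R :> R by rewrite ler_nat.
rewrite [`|K%:R^-1|]ger0_norm ?invr_ge0 // ler_pdivrMr; last by lra.
apply: (@le_trans _ _ 1); last by lra.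
by rewrite ler_norml; case: x => /=; lra.
Qed.

Lemma bet_factor_bounds P s x : unit_valued P -> 0 < 1 + bet P s x <= 2.
Proof. by move=> hP; have := normr_bet_le s x hP; rewrite ler_norml; lra. Qed.

Lemma capital_gt0 P s : unit_valued P -> 0 < capital P s.
Proof.
move=> hP; apply: prodr_gt0 => k _.
by have /andP[] := bet_factor_bounds (take k s) (nth false s k) hP.
Qed.

Lemma capital_nil P : capital P [::] = 1.
Proof. by rewrite /capital big_ord0. Qed.

Definition forecast_end (phi : forecasting_system R) (c : bool) s : R :=
  if c then upper_end (phi s) else lower_end (phi s).

Lemma forecast_end_unit phi c : unit_valued (forecast_end phi c).
Proof.
move=> s; rewrite /forecast_end; have := lower_end_ge0 (phi s).
have := lower_le_upper (phi s); have := upper_end_le1 (phi s).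
by case: c; lra.
Qed.

Lemma capital_test_supermartingale (phi : forecasting_system R) :
  test_supermartingale phi (capital (forecast_end phi b)).
Proof.
set P := forecast_end _ _; have hP : unit_valued P by exact: forecast_end_unit.
split; first by split=> [s|]; [exact/ltW/capital_gt0|exact: capital_nil].
move=> s; have lu := lower_le_upper (phi s).
apply: ge_sup.
  exists (Defs.expectation (lower_end (phi s)) (difference (capital P) s)).
  by exists (lower_end (phi s)) => //=; rewrite /interval_set /=; lra.
move=> _ [p /= /andP[lp pu] <-]; rewrite /Defs.expectation /difference !capital_rcons.
have c0 := ltW (capital_gt0 s hP).
rewrite /bet; case: ifP => _; last by rewrite addr0 mulr1 subrr !mulr0 addr0.
have Ki : 0 <= K%:R^-1 :> R by rewrite invr_ge0.
(* The increment is affine in the outcome, so the expectation replaces the outcome by p; the last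
   factor is at most 0 because P is the end point chosen by [b]. *)
rewrite (_ : _ + _ = capital P s * K%:R^-1 * ((-1) ^+ b * (P s - p))); last first.
  by move: ((-1) ^+ b) K%:R^-1 => /= c i; ring.
rewrite mulr_ge0_le0 ?mulr_ge0 //.
by rewrite /P /forecast_end; case: b => /=; rewrite ?expr1 ?expr0; lra.
Qed.

(** With capitals q, p and bets y, z, use $q(1+y)-p(1+z)=(q-p)(1+y)+p(y-z)$. Factors are at most 2,
    so the error after n + 1 steps is at most $2\cdot 4^n e + 2^n e \le 4^{n+1} e$. *)
Lemma capital_close P Q s (e : R) : unit_valued P -> unit_valued Q -> 0 <= e ->
  (forall k, (k < size s)%N -> `|Q (take k s) - P (take k s)| <= e) ->
  `|capital Q s - capital P s| <= 4 ^+ size s * e.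
Proof.
move=> hP hQ e0.
have le2n Q' s' : unit_valued Q' -> 0 <= capital Q' s' <= 2 ^+ size s'.
  move=> hQ'; rewrite ltW ?capital_gt0 //=; elim/last_ind: s' => [|s' x IH].
    by rewrite capital_nil expr0.
  have /andP[f0 f2] := bet_factor_bounds s' x hQ'.
  rewrite capital_rcons size_rcons exprSr.
  by apply: ler_pM => //; apply: ltW => //; exact: capital_gt0.
elim/last_ind: s => [|s x IH] h.
  by rewrite !capital_nil subrr normr0 mulr_ge0 // exprn_ge0.
have {}IH : `|capital Q s - capital P s| <= 4 ^+ size s * e.
  apply: IH => k ks; have := h k; rewrite size_rcons => /(_ (ltnW ks)).
  by rewrite -cats1 takel_cat // ltnW.
have hs : `|Q s - P s| <= e.
  by have := h (size s); rewrite size_rcons => /(_ (leqnn _)); rewrite -cats1 take_size_cat.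
rewrite !capital_rcons size_rcons.
set q := capital Q s in IH *; set p := capital P s in IH *.
set y := bet Q s x; set z := bet P s x.
have yz : `|y - z| <= e.
  rewrite /y /z /bet; case: ifP => _; last by rewrite subrr normr0.
  rewrite -mulrBl -mulrBr !normrM normrX normrN1 expr1n mul1r opprB addrA subrK.
  have K0 : 1 <= K%:R :> R by rewrite (ler_nat _ 1) ltnW.
  rewrite [`|K%:R^-1|]ger0_norm ?invr_ge0 // ler_pdivrMr; last by lra.
  by apply: le_trans hs _; rewrite ler_peMr.
have /andP[y0 y2] := bet_factor_bounds s x hQ.
have /andP[p0 p2] := le2n P s hP.
rewrite (_ : q * _ - _ = (q - p) * (1 + y) + p * (y - z)); last by ring.
apply: le_trans (ler_normD _ _) _; rewrite !normrM.
rewrite (ger0_norm p0) (gtr0_norm y0).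
have h1 : `|q - p| * (1 + y) <= 4 ^+ size s * e * 2 by apply: ler_pM => //; exact: ltW.
have h2 : p * `|y - z| <= 2 ^+ size s * e by rewrite ler_pM.
have h3 : 2 ^+ size s * e <= 4 ^+ size s * e.
  by rewrite ler_wpM2r //; apply: lerXn2r; rewrite ?nnegrE ?ler_nat.
have h4 : 0 <= 4 ^+ size s * e by rewrite mulr_ge0 // exprn_ge0.
rewrite exprS -mulrA; move: h1 h2 h3 h4.
move: (4 ^+ size s * e) (2 ^+ size s * e) (`|q - p| * (1 + y)) (p * `|y - z|) => *; lra.
Qed.

End Capital.

(** * Computability of the capital process *)

Section Computability.
Context {R : realType}.
Variables (sigma : nat -> bool) (K : nat) (b : bool).
Hypothesis K2 : (1 < K)%N.

Lemma bet_rational (q den : nat) (x : bool) : (0 < den)%N -> (q <= den)%N ->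
  1 + (-1) ^+ b * (q%:R / den%:R - x%:R) / K%:R =
  (if b then K * den + x * den - q else K * den + q - x * den)%N%:R / (K * den)%N%:R :> R.
Proof.
move=> d0 qd.
have K0 : K%:R != 0 :> R by rewrite pnatr_eq0; lia.
have d0' : den%:R != 0 :> R by rewrite pnatr_eq0; lia.
have xd : (x * den <= K * den)%N by rewrite leq_mul2r; apply/orP; right; case: x => //; exact: ltnW.
have qK : (q <= K * den)%N by rewrite (leq_trans qd) // leq_pmull // ltnW.
by case: b; rewrite natrB ?natrD ?natrM ?expr0 ?expr1; try lia; field; rewrite ?K0 ?d0'.
Qed.

Lemma computable_capital (P : situation -> R) :
  recursive_selection sigma -> unit_valued P -> computable_process P ->
  computable_process (capital sigma K b P).
Proof.
move=> rsigma hP [r [e [[sg [num [den [hsg hnum hden rE]]]] [ge rge eE] rP]]].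
move: hsg hnum hden => [gs rgs sgE] [gn rgn numE] [gd rgd denE].
have [rn rd rm] := recursive_capital K b rgs rgn rgd rge rsigma.
pose cn (d : situation * nat) := capital_num gs gn gd sigma K b (situation_code d.1) d.2.
pose cd (d : situation * nat) := capital_den gd sigma K (situation_code d.1) d.2.
pose cm (d : situation * nat) := capital_modulus ge (situation_code d.1) d.2.
(* The n-th approximation of P, clamped to [0, 1]; its capital is exactly the rational [cn / cd]. *)
pose Q n (s : situation) : R :=
  (if odd (sg (s, n)) then 0%N else minn (num (s, n)) (den (s, n)))%:R / (den (s, n))%:R.
have d0 s n : (0 < den (s, n))%N by have [] := rE (s, n).
have QE s n : (cn (s, n))%:R / (cd (s, n))%:R = capital sigma K b (Q n) s.
  rewrite /cn /cd /capital_num /capital_den code_lengthE /capital /=.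
  rewrite !natr_prod -prodf_div; apply: eq_bigr => k _.
  rewrite odd_prefix_code // prefix_codeE; last exact: ltnW.
  have ks : size (take k s) = k by rewrite size_takel // ltnW.
  rewrite /bet_num /bet_den /clamped_num /bet ks; case: ifP => _; last by rewrite divr1 addr0.
  have := d0 (take k s) n; rewrite /Q sgE numE denE /situation_nat_code /= => d1.
  by apply/esym/bet_rational => //; case: ifP => // _; exact: geq_minr.
exists (fun d => (-1) ^+ 0 * (cn d)%:R / (cd d)%:R), cm; split.
- exists (fun _ => 0%N), cn, cd; split.
  + by exists (fun _ => 0%N) => //; exact: recursive_const.
  + by apply: (ex_intro2 _ _ _ rn) => -[s n]; rewrite /situation_nat_code Cantor.cancel_of_to.
  + by apply: (ex_intro2 _ _ _ rd) => -[s n]; rewrite /situation_nat_code Cantor.cancel_of_to.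
  + move=> [s n]; split=> //; rewrite /cd /capital_den code_lengthE prodn_gt0 // => k.
    rewrite [X in Cantor.to_nat (X, _)]prefix_codeE; last exact: ltnW.
    rewrite /bet_den; case: ifP => // _.
    by rewrite muln_gt0 (ltnW K2); have := d0 (take k s) n; rewrite denE.
- by apply: (ex_intro2 _ _ _ rm) => -[s n]; rewrite /situation_nat_code Cantor.cancel_of_to.
- move=> s N n; rewrite /cm /= /capital_modulus code_lengthE => hn.
  rewrite expr0 mul1r fmorph_div /= !ratr_nat QE.
  have hQ m : unit_valued (Q m).
    move=> t; rewrite /Q divr_ge0 //= ler_pdivrMr ?ltr0n // mul1r ler_nat.
    by case: ifP => // _; exact: geq_minr.
  (* The added precision $2^{-2|s|}$ cancels the error factor $4^{|s|}$. *)
  apply: (@le_trans _ _ (4 ^+ size s * 2 ^- (N + (size s).*2))); last first.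
    rewrite -mul2n exprD exprM invfM mulrCA (_ : 2 ^+ 2 = 4); last by ring.
    by rewrite divff ?mulr1 // expf_neq0.
  apply: capital_close => // k ks.
  have tk : `|ratr (r (take k s, n)) - P (take k s)| <= 2 ^- (N + (size s).*2).
    apply: rP; apply: leq_trans hn.
    (* The modulus is a sum of natural numbers, hence at least its summand for the prefix of length
       k. *)
    rewrite (bigD1 (Ordinal (ltnW ks : (k < (size s).+1)%N))) //=.
    by rewrite prefix_codeE ?eE ?leq_addr // ltnW.
  (* Clamping to [0, 1] does not increase the distance to a point of [0, 1]: a negative
     approximation becomes 0, one above 1 becomes 1. *)
  apply: le_trans tk; have [_ ->] := rE (take k s, n).
  rewrite fmorph_div /= rmorphM rmorphXn rmorphN1 /= !ratr_nat /Q.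
  have dR : 0 < (den (take k s, n))%:R :> R by rewrite ltr0n.
  have /andP[P0 P1] := hP (take k s); move: (P _) P0 P1 => p P0 P1.
  rewrite -signr_odd; case: odd => /=.
    rewrite mul0r sub0r normrN ger0_norm // expr1 mulN1r mulNr.
    have : 0 <= (num (take k s, n))%:R / (den (take k s, n))%:R :> R by rewrite divr_ge0.
    by move=> ?; rewrite ler0_norm; [lra|lra].
  rewrite expr0 mul1r /minn; case: ltnP => [_|dn]; first exact: lexx.
  have q1 : 1 <= (num (take k s, n))%:R / (den (take k s, n))%:R :> R.
    by rewrite ler_pdivlMr // mul1r ler_nat.
  by rewrite divff ?gt_eqF // !ger0_norm; [lra|lra|lra].
Qed.

End Computability.

(** * Randomness along the path *)

Section Asymptotics.
Context {R : realType}.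
Implicit Types (u : nat -> R).

Lemma limn_einf_ge0 u :
  (forall e : R, 0 < e -> exists n0, forall n, (n0 <= n)%N -> - e <= u n) ->
  (0 <= limn_einf (fun n => (u n)%:E))%E.
Proof.
move=> h; rewrite limn_einf_lim; apply/lee_addgt0Pr => e e0.
rewrite -leeBlDr // sub0e; have [n0 hn0] := h e e0.
apply: lime_ge; first exact: is_cvg_einfs.
exists n0 => // n /= n0n; apply: le_ereal_inf_tmp => _ [m /= nm <-].
by have := hn0 m (leq_trans n0n nm); rewrite -lee_fin.
Qed.

Lemma limn_esup_ge u (c : R) :
  (forall n0, exists2 n, (n0 <= n)%N & c <= u n) ->
  (c%:E <= limn_esup (fun n => (u n)%:E))%E.
Proof.
move=> h; rewrite limn_esup_lim; apply: lime_ge; first exact: is_cvg_esups.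
apply: nearW => n; have [m nm cm] := h n.
apply: (@le_trans _ _ (u m)%:E); first by rewrite lee_fin.
by apply: ereal_sup_ubound; exists m.
Qed.

(** For $y = x - 2x^2 < 1$, the bound $e^{-y} \ge 1-y$ gives $e^y \le 1/(1-y)$, and $(1+x)(1-y) = 1
    + x^2(1+2x) \ge 1$. *)
Lemma expR_le_factor (x : R) : `|x| <= 2^-1 -> expR (x - 2 * x ^+ 2) <= 1 + x.
Proof.
rewrite ler_norml => /andP[x1 x2]; set y := x - _.
have := expR_ge1Dx (- y); rewrite expRN => h.
have y1 : 0 < 1 - y by rewrite /y; nra.
apply: (@le_trans _ _ (1 - y)^-1).
  by rewrite -[expR y]invrK lef_pV2 // posrE invr_gt0 expR_gt0.
rewrite -[_^-1]mul1r ler_pdivrMr // /y.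
rewrite (_ : (1 + x) * _ = 1 + x ^+ 2 * (1 + 2 * x)); last by ring.
by rewrite lerDl mulr_ge0 ?sqr_ge0 //; lra.
Qed.

(** The left-hand side is $(1+x/2)^2$, and $1 + x/2 \le e^{x/2}$. *)
Lemma expR_ge_sqr (x : R) : 0 <= x -> 1 + x + x ^+ 2 / 4 <= expR x.
Proof.
move=> x0; have h := expR_ge1Dx (x / 2).
rewrite (_ : x = x / 2 + x / 2) ?expRD; last by lra.
have -> : 1 + (x / 2 + x / 2) + (x / 2 + x / 2) ^+ 2 / 4 = (1 + x / 2) * (1 + x / 2) by field.
by rewrite ler_pM //; lra.
Qed.

(** The expectation is affine in p with slope h(1) - h(0), whose sign tells at which end point the
    minimum lies. *)
Lemma lower_expectationE (I : interval_forecast R) (h : bool -> R) :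
  lower_expectation I h =
  h false + (h true - h false) *
    (if h true < h false then upper_end I else lower_end I).
Proof.
have lu := lower_le_upper I.
set p := if _ then _ else _; set v := h false + _.
have pI : interval_set I p by rewrite /interval_set /p /=; case: ifP => _; lra.
have vE : Defs.expectation p h = v by rewrite /Defs.expectation /v; ring.
have lb q : interval_set I q -> v <= Defs.expectation q h.
  rewrite /interval_set /= -vE /Defs.expectation /p => /andP[q1 q2].
  by case: ltP => hh; nra.
apply/eqP; rewrite eq_le; apply/andP; split.
  rewrite -vE; apply: ge_inf; last by exists p.
  by exists v => _ [q /lb h1 <-].
apply: lb_le_inf; first by exists v, p.
by move=> _ [q /lb h1 <-].
Qed.

(** * Capital and selected averages along the path *)

Section AlongPath.
Variables (sigma : nat -> bool) (omega : binary_path).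
Hypothesis sigma_infinite : (\sum_(k < n) (sigma k)%:R : R) @[n --> \oo] --> +oo.

Definition selected_number (n : nat) : nat := (\sum_(k < n) sigma k)%N.

Lemma selected_numberE n : \sum_(k < n) (sigma k)%:R = (selected_number n)%:R :> R.
Proof. by rewrite /selected_number natr_sum. Qed.

Lemma selected_number_ge (B : nat) :
  exists n0, forall n, (n0 <= n)%N -> (B <= selected_number n)%N.
Proof.
have /cvgryPge/(_ B%:R)[n0 _ h] := sigma_infinite.
by exists n0 => n /h /=; rewrite selected_numberE ler_nat.
Qed.

Lemma selected_number_homo : {homo selected_number : m n / (m <= n)%N}.
Proof.
move=> m n mn; rewrite /selected_number -(subnKC mn) big_split_ord /=.
exact: leq_addr.
Qed.

Definition selected_gain (b : bool) (P : situation -> R) (n : nat) : R :=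
  \sum_(k < n) (sigma k)%:R *
    ((-1) ^+ b * (P (initial_segment omega k) - (omega k)%:R)).

(** With N selected times, the bets sum to at least $3N/K^2$ and their squares to at most $N/K^2$,
    so the exponent, the sum of $x - 2x^2$, is at least $y = N/K^2$. Then $e^y \ge 1 + y^2/4$, and
    $y^2/4 = N \cdot N/(4K^4) \ge N$. *)
Lemma capital_ge (b : bool) (P : situation -> R) (K n : nat) :
  (1 < K)%N -> unit_valued P -> (4 * K ^ 4 <= selected_number n)%N ->
  3 / K%:R * (selected_number n)%:R <= selected_gain b P n ->
  (selected_number n)%:R + 1 <= capital sigma K b P (initial_segment omega n).
Proof.
move=> K2 hP; set N := selected_number n => hN hS.
have K0 : 0 < K%:R :> R by rewrite ltr0n ltnW.
pose x k := bet sigma K b P (initial_segment omega k) (omega k).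
have xE k : x k = (sigma k)%:R * ((-1) ^+ b * (P (initial_segment omega k) - (omega k)%:R)) / K%:R.
  rewrite /x /bet size_mkseq; case: (sigma k); rewrite ?mul0r ?mul0r //.
  by rewrite mul1r.
have x2 k : x k ^+ 2 <= (sigma k)%:R / K%:R ^+ 2.
  rewrite xE; case: (sigma k); last by rewrite !mul0r expr0n.
  rewrite expr_div_n ler_wpM2r ?invr_ge0 ?exprn_ge0 // mul1r exprMn sqrr_sign mul1r.
  have /andP[] := hP (initial_segment omega k); move: (P _) => p p0 p1.
  by case: (omega k) => /=; nra.
have h1 : expR (\sum_(k < n) (x k - 2 * x k ^+ 2)) <= capital sigma K b P (initial_segment omega n).
  rewrite capital_initial_segment expR_sum; apply: ler_prod => k _.
  by rewrite expR_ge0 expR_le_factor // normr_bet_le.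
have h2 : N%:R / K%:R ^+ 2 <= \sum_(k < n) (x k - 2 * x k ^+ 2).
  rewrite sumrB -mulr_sumr.
  have e1 : \sum_(k < n) x k = selected_gain b P n / K%:R.
    by rewrite /selected_gain mulr_suml; apply: eq_bigr => k _; rewrite xE.
  have e2 : \sum_(k < n) x k ^+ 2 <= N%:R / K%:R ^+ 2.
    by rewrite -selected_numberE mulr_suml ler_sum.
  have e3 : 3 / K%:R * N%:R / K%:R <= selected_gain b P n / K%:R.
    by rewrite ler_wpM2r // invr_ge0 ltW.
  rewrite (_ : 3 / K%:R * N%:R / K%:R = 3 * (N%:R / K%:R ^+ 2)) in e3; last first.
    by field; rewrite gt_eqF.
  by rewrite e1; lra.
apply: le_trans h1; apply: (@le_trans _ _ (expR (N%:R / K%:R ^+ 2))); last by rewrite ler_expR.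
set y := N%:R / K%:R ^+ 2.
have y0 : 0 <= y by rewrite /y divr_ge0 // exprn_ge0.
apply: le_trans (expR_ge_sqr y0).
suff : N%:R <= y ^+ 2 / 4 by lra.
have hN' : 4 * K%:R ^+ 4 <= N%:R :> R by rewrite -natrX -natrM ler_nat.
rewrite (_ : y ^+ 2 / 4 = N%:R * (N%:R / (4 * K%:R ^+ 4))); last first.
  by rewrite /y; field; rewrite gt_eqF.
by rewrite ler_peMr // ler_pdivlMr ?mul1r // mulr_gt0 // exprn_gt0.
Qed.

(** Schnorr randomness is contradicted only by a positive upper limit of T - N, whence the summand
    1. *)
Definition capital_outgrows (T : situation -> R) :=
  forall n0, exists2 n, (n0 <= n)%N &
    (selected_number n)%:R + 1 <= T (initial_segment omega n).

Lemma outgrown_not_schnorr (phi : forecasting_system R) (T : situation -> R) :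
  recursive_selection sigma -> computable_process T -> test_supermartingale phi T ->
  capital_outgrows T -> ~ schnorr_random phi omega.
Proof.
move=> rsigma cT sT hT /(_ T selected_number cT sT).
have gr : growth_function selected_number.
  split; [exact: recursive_partial_sum rsigma|exact: selected_number_homo|].
  by move=> B; have [n h] := selected_number_ge B.+1; exists n; exact: h.
move=> /(_ gr); apply/negP; rewrite -ltNge; apply: (@lt_le_trans _ _ 1%:E) => //.
apply: limn_esup_ge => n0; have [n n0n h] := hT n0.
by exists n => //; lra.
Qed.

Lemma outgrown_not_random (A : set (situation -> R)) (phi : forecasting_system R)
    (T : situation -> R) :
  A T -> test_supermartingale phi T -> capital_outgrows T ->
  ~ allowable_random A phi omega.
Proof.
move=> AT sT hT /(_ T AT sT); apply/negP; rewrite -leNgt leye_eq; apply/eqP/eqyP => r r0.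
have [n1 hn1] := selected_number_ge (Num.truncn r).+1.
(* The supremum ranges over n >= 1 only, hence the 1; from [n1] on the number of selected times
   exceeds r. *)
have [n] := hT (maxn 1 n1); rewrite geq_max => /andP[n0 n1n] hn.
apply: (@le_trans _ _ (T (initial_segment omega n))%:E); last first.
  by apply: ereal_sup_ubound; exists n.
have := truncnS_gt r; have := hn1 n n1n; rewrite -(ler_nat R) lee_fin; lra.
Qed.

(** Each term is $(h(1)-h(0))(\omega_k - p)$ with p the minimizing end point. The sign of
    $h(1)-h(0)$ fixes both this end point and the direction of the bet, and its absolute value is a
    common factor. *)
Lemma selected_averageE (phi : forecasting_system R) (I : nat -> interval_forecast R)
    (h : bool -> R) n :
  (forall k, I k = forecast_along phi omega k) ->
  selected_average I sigma h omega n =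
  - (`|h true - h false| *
     (selected_gain (h true < h false) (forecast_end phi (h true < h false)) n /
      (selected_number n)%:R)).
Proof.
move=> hI; rewrite /selected_average selected_numberE mulrA -mulNr; congr (_ / _).
rewrite /selected_gain mulr_sumr -sumrN; apply: eq_bigr => k _.
rewrite lower_expectationE hI /forecast_along /forecast_end.
have -> : h (omega k) = h false + (h true - h false) * (omega k)%:R.
  by case: (omega k); rewrite /= ?mulr1 ?mulr0; ring.
move: (if _ then upper_end _ else _) ((omega k)%:R : R) ((sigma k)%:R : R) => p w c.
case: ltP => hh; rewrite ?expr1 ?expr0.
- by rewrite ltr0_norm ?subr_lt0 //; ring.
- by rewrite ger0_norm ?subr_ge0 //; ring.
Qed.

Lemma selected_average_liminf (phi : forecasting_system R)
    (I : nat -> interval_forecast R) (h : bool -> R) :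
  (forall k, I k = forecast_along phi omega k) ->
  (forall (b : bool) (K : nat), (1 < K)%N ->
     ~ capital_outgrows (capital sigma K b (forecast_end phi b))) ->
  (0 <= limn_einf (fun n => (selected_average I sigma h omega n)%:E))%E.
Proof.
move=> hI hC; apply: limn_einf_ge0 => e e0.
apply: contrapT => /forallNP hn.
set b := h true < h false; set d := `|h true - h false|.
have d0 : 0 <= d by exact: normr_ge0.
(* An average below -e means a gain per selected time above e / d, and K is chosen so that this is
   at least 3 / K; the successor taken twice ensures K > 1. *)
pose K := (Num.truncn (3 * d / e)).+2.
have Kd : 3 * d / e <= K%:R.
  have := truncnS_gt (3 * d / e); rewrite /K -[_.+2]addn1 natrD; lra.
apply: (hC b K isT) => n0.
have [n1 hn1] := selected_number_ge (4 * K ^ 4).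
have [n hn'] : exists n, (maxn n0 n1 <= n)%N /\ selected_average I sigma h omega n < - e.
  apply: contrapT => /forallNP h0; apply: (hn (maxn n0 n1)) => n n01.
  by rewrite leNgt; apply/negP => av; apply: (h0 n).
case: hn'; rewrite geq_max => /andP[n0n n1n] av.
exists n => //; apply: capital_ge => //; last 1 first.
- have K0 : 0 < K%:R :> R by rewrite ltr0n.
  have N0 : 0 < (selected_number n)%:R :> R.
    by rewrite ltr0n; apply: leq_trans (hn1 n n1n); rewrite muln_gt0 expn_gt0.
  move: av; rewrite (selected_averageE _ _ hI) -/b -/d ltrN2.
  set g := selected_gain _ _ _ => av.
  (* For d = 0 the average would be 0, which is not below -e. *)
  have d1 : 0 < d.
    rewrite lt_neqAle d0 andbT; apply/eqP => d00.
    by move: av; rewrite -d00 mul0r; lra.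
  move: av Kd; rewrite mulrA ltr_pdivlMr // ler_pdivrMr // => av Kd.
  rewrite mulrAC ler_pdivrMr //.
  have : 3 * d * (selected_number n)%:R <= K%:R * e * (selected_number n)%:R.
    by rewrite ler_pM2r.
  have : K%:R * (e * (selected_number n)%:R) <= K%:R * (d * g) by rewrite ler_pM2l // ltW.
  move=> k1 k2; rewrite -(ler_pM2l d1); move: k1 k2; nra.
- exact: forecast_end_unit.
- exact: hn1.
Qed.

End AlongPath.
End Asymptotics.

Theorem theorem24 (R : realType) (phi : forecasting_system R)
    (omega : binary_path) (I : nat -> interval_forecast R)
    (sigma : selection_function)
    (hphi : computable_forecasting_system phi)
    (hI : forall k : nat, I k = forecast_along phi omega k)
    (hsigma : recursive_selection sigma)
    (hinf : (\sum_(k < n) (sigma k)%:R : R) @[n --> \oo] --> +oo) :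
  (forall A : set (situation -> R),
     allowable A -> allowable_random A phi omega ->
     forall h : bool -> R,
       (0 <= limn_einf (fun n => (selected_average I sigma h omega n)%:E))%E)
  /\
  (schnorr_random phi omega ->
     forall h : bool -> R,
       (0 <= limn_einf (fun n => (selected_average I sigma h omega n)%:E))%E).
Proof.
have cP b : computable_process (forecast_end phi b) by case: hphi; case: b.
have cT b K : (1 < K)%N -> computable_process (capital sigma K b (forecast_end phi b)).
  by move=> K2; apply: computable_capital => //; exact: forecast_end_unit.
have sT b K : (1 < K)%N -> test_supermartingale phi (capital sigma K b (forecast_end phi b)).
  by move=> K2; apply: capital_test_supermartingale.
split=> [A [_ _ hA] rA h | rS h].
- apply: (@selected_average_liminf R sigma omega hinf phi I h hI) => b K K2 out.
  apply: (outgrown_not_random hinf _ (sT b K K2) out rA).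
  apply: hA; [by case: (sT b K K2)| |exact: cT].
  by move=> s; apply: capital_gt0 => //; exact: forecast_end_unit.
- apply: (@selected_average_liminf R sigma omega hinf phi I h hI) => b K K2 out.
  exact: (outgrown_not_schnorr hinf hsigma (cT b K K2) (sT b K K2) out rS).
Qed.
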